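(* For every fixed $\varepsilon > 0$, the algorithm $A^{\text{eq-prof}}_{\varepsilon}$ returns a $(1+\varepsilon)^2$-approximate solution to the identical machine scheduling problem with a non-fixed number of machines, after processing at most $\frac{2m^{f(\varepsilon)+1}}{\varepsilon}$ nodes in the branching tree for some function $f$.
   Context: Identical machine scheduling problem ($P||C_{max}$): $n$ jobs with integer processing times $p_j$ are to be assigned to $m$ identical machines ($m$ part of the input) to minimize the makespan (maximum machine completion time). For a processing-time matrix $\bm{P}$ (here $p_{j,i}=p_j$), an overhead vector $\bm{t}\in\mathbb{N}^m$ (completion times already caused by fixed jobs) and a guess $T$, let $PARTIAL\text{-}LP\text{-}MS_m(\bm{P},\bm{t},T)$ be the polyhedron $\{x\ge 0: \sum_{i:(j,i)\in S_T} x_{j,i}=1\ \forall j,\ \sum_{j:(j,i)\in S_T} p_{j,i}x_{j,i}\le T-t_i\ \forall i\}$, where $S_T=\{(j,i): p_{j,i}\le T\}$. The algorithm $A^{\text{eq-prof}}_{\varepsilon}$ is the following branch-and-bound method. It sorts jobs so that $p_1\ge\dots\ge p_n$ and divides all processing times by the smallest $T$ for which $PARTIAL\text{-}LP\text{-}MS_m(\bm{P},\bm{0},T)$ is feasible, so that the optimal makespan satisfies $1\le T_{opt}\le 2$. Each node fixes some job–machine pairings, giving an overhead vector $\bm{t}_v$ (the node's profile). Bounding at node $v$: $LB(v)$ is the smallest integer $T'$ for which $PARTIAL\text{-}LP\text{-}MS_m(\bm{P}_v,\bm{t}_v,T')$ is feasible; a vertex of this polyhedron is found (if it is integral the algorithm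 stops), chosen so that the longest unfixed job is fractional, and $UB(v)$ is the makespan of the integer schedule obtained by assigning fractional jobs to machines via the Lenstra–Shmoys–Tardos matching. Branching: the longest unfixed job is fixed on each of the $m$ machines, creating $m$ children (so all nodes at depth $i$ have fixed exactly jobs $1,\dots,i$). A child $u$ is discarded if $LB(u)$ exceeds the makespan of an already found schedule, if some overhead exceeds $2(1+\varepsilon)^2$, or if its profile is $\varepsilon$-equivalent to that of an already generated node at the same depth. Selection is best-first (active node with smallest lower bound). It terminates when (best found makespan)/(smallest lower bound among active nodes) $\le 1+\varepsilon$, returning the best schedule found. $\varepsilon$-equivalence: a job is small if $p_j<\varepsilon$, big otherwise. For $\varepsilon\le x\le 2(1+\varepsilon)^2$ let $round(x)=\sup\{\varepsilon(1+\varepsilon)^k: k\in\mathbb{N},\ \varepsilon(1+\varepsilon)^k\le x\}$; for a partial schedule $S$ of big jobs, $round(S)$ replaces each $p_j$ by $round(p_j)$. Each machine completion time in $round(S)$ (makespan at most $2(1+\varepsilon)^2$) takes one of at most $f(\varepsilon)=8\cdot(1/\varepsilon)^{\log_{1+\varepsilon}\frac{2(1+\varepsilon)^2}{\varepsilon}}$ possible values; with a fixed enumeration of these values, the profile $\Pi_{new}(S)=(c_1(S),\dots,c_{f(\varepsilon)}(S))$ records how many machines have each value. Two partial schedules are $\varepsilon$-equivalent if their profiles $\Pi_{new}$ coincide.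
   Formalization: A node at which the algorithm stops because its vertex is integral is not counted as processed (else the bound fails for m = 1, ε > 2: the root alone exceeds 2/ε); ''smallest integer T''' in LB(v) is read in the units of the original, unscaled processing times. *)

(* Defs.v *)
From HB Require Import structures.
From mathcomp Require Import all_boot all_order all_algebra all_fingroup.
From mathcomp Require Import boolp classical_sets reals.

Set Implicit Arguments.
Unset Strict Implicit.
Unset Printing Implicit Defensive.

Import Order.TTheory GRing.Theory Num.Theory.
Local Open Scope classical_set_scope.
Local Open Scope ring_scope.

(* The least element of A (0 if A has none). *)
Definition smallest (R : realType) (A : set R) : R :=
  xget 0 [set a | A a /\ lbound A a].

(* Identical machines: job j takes time t j on every machine. *)
Definition makespan (R : realType) (n m : nat)
    (t : 'I_n -> R) (S : {ffun 'I_n -> 'I_m}) : R :=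
  \big[Num.max/0]_(i < m) \sum_(j < n | S j == i) t j.

Definition approximate_solution (R : realType) (n m : nat)
    (alpha : R) (p : 'I_n -> nat) (S : {ffun 'I_n -> 'I_m}) : Prop :=
  forall S' : {ffun 'I_n -> 'I_m},
    makespan (fun j => (p j)%:R) S <= alpha * makespan (fun j => (p j)%:R) S'.

(* The variables are the x (j, i) with P j i <= T; in the ambient space of all
   pairs (j, i) the missing coordinates are fixed to 0. *)
Definition partial_LP (R : realType) (J : finType) (m : nat)
    (P : J -> 'I_m -> R) (t : 'I_m -> R) (T : R) : set {ffun J * 'I_m -> R} :=
  [set x | [/\ forall j i, 0 <= x (j, i),
               forall j i, T < P j i -> x (j, i) = 0,
               forall j, \sum_(i < m | P j i <= T) x (j, i) = 1 &
               forall i, \sum_(j | P j i <= T) P j i * x (j, i) <= T - t i]].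

Definition is_vertex (R : realType) (K : finType)
    (A : set {ffun K -> R}) (x : {ffun K -> R}) : Prop :=
  A x /\ forall (y z : {ffun K -> R}) (a : R), A y -> A z -> 0 < a < 1 ->
           (forall k, x k = a * y k + (1 - a) * z k) -> y = z.

(* All the definitions below take the processing times p in the order in which
   the jobs get fixed; [A_eq_prof_returns] supplies them in sorted order. *)

Section Scaling.
Context (R : realType) (n m : nat) (p : 'I_n -> nat).

Definition scale : R :=
  smallest [set T | partial_LP (fun (j : 'I_n) (_ : 'I_m) => (p j)%:R)
                               (fun _ => 0) T !=set0].

Definition scaled (j : 'I_n) : R := (p j)%:R / scale.

End Scaling.

(* A node at depth d is the sequence of the machines on which the jobs
   0, ..., d-1 are fixed. *)
Definition node (m : nat) := seq 'I_m.

Definition schedule (n m : nat) := {ffun 'I_n -> 'I_m}.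

Definition unfixed (n m : nat) (v : node m) := {j : 'I_n | (size v <= j)%N}.

Section Bounding.
Context (R : realType) (n m : nat) (p : 'I_n -> nat).
Implicit Types (v : node m).

Local Notation q := (@scaled R n m p).

Definition overhead v (i : 'I_m) : R :=
  \sum_(j < n | onth v j == Some i) q j.

Definition node_LP v (T : R) : set {ffun unfixed n v * 'I_m -> R} :=
  partial_LP (fun (j : unfixed n v) (_ : 'I_m) => q (val j)) (overhead v) T.
Arguments node_LP v T : clear implicits.

(* The guesses are integers in the units of the original instance, that is,
   integer multiples of 1 / scale after the scaling. *)
Definition LB v : R :=
  smallest [set T | T * scale R m p \is a Num.int /\ node_LP v T !=set0].

Definition integral v (x : {ffun unfixed n v * 'I_m -> R}) : Prop :=
  forall j i, x (j, i) \is a Num.int.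

Definition fractional v (x : {ffun unfixed n v * 'I_m -> R}) (j : unfixed n v) : Prop :=
  exists i, x (j, i) \isn't a Num.int.

(* As the jobs are sorted, the longest unfixed job has index [size v]. *)
Definition bounding_vertex v (x : {ffun unfixed n v * 'I_m -> R}) : Prop :=
  is_vertex (node_LP v (LB v)) x /\
  (integral x \/
   forall j : unfixed n v, val j = size v :> nat -> fractional x j).

(* An integrally assigned job stays on its machine (the only i with
   0 < x (j, i)); the fractional jobs are matched, along the edges of the
   support of x, to pairwise distinct machines. *)
Definition matching_schedule v (x : {ffun unfixed n v * 'I_m -> R})
    (S : schedule n m) : Prop :=
  [/\ forall (j : 'I_n) (i : 'I_m), onth v j = Some i -> S j = i,
      forall j : unfixed n v, 0 < x (j, S (val j)) &
      forall j j' : unfixed n v, fractional x j -> fractional x j' ->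
        S (val j) = S (val j') -> j = j'].

End Bounding.

Section Equivalence.
Context (R : realType) (n m : nat) (eps : R) (p : 'I_n -> nat).
Implicit Types (v : node m).

Local Notation q := (@scaled R n m p).

Definition big (j : 'I_n) : bool := eps <= q j.

Definition round (x : R) : R :=
  sup [set y | exists2 k : nat, y = eps * (1 + eps) ^+ k & y <= x].

Definition rounded_load v (i : 'I_m) : R :=
  \sum_(j < n | big j && (onth v j == Some i)) round (q j).

(* The profile is indexed by the completion times themselves instead of by
   their positions in an enumeration of the possible values. *)
Definition profile v : R -> nat :=
  fun c => #|[pred i : 'I_m | rounded_load v i == c]|.

Definition eps_equivalent (u v : node m) : Prop := profile u = profile v.

End Equivalence.

(* [found] lists the schedules found so far, [generated] all the nodes created
   so far, and [processed] counts the nodes selected so far. *)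
Record state (n m : nat) := State {
  active : seq (node m);
  generated : seq (node m);
  found : seq (schedule n m);
  processed : nat }.

Variant config (n m : nat) :=
  | Running of state n m
  | Returned of schedule n m & nat.

Section Algorithm.
Context (R : realType) (n m : nat) (eps : R) (p : 'I_n -> nat).
Implicit Types (u v : node m) (S : schedule n m) (s : state n m).

Local Notation q := (@scaled R n m p).
Local Notation LB := (@LB R n m p).

Definition selected (act : seq (node m)) v : Prop :=
  v \in act /\ forall u, u \in act -> LB v <= LB u.

Definition best_of (fnd : seq (schedule n m)) S : Prop :=
  S \in fnd /\ forall S', S' \in fnd -> makespan q S <= makespan q S'.

(* The ratio to the smallest lower bound is at most 1 + eps; this also holds
   when no active node is left. *)
Definition gap_closed (fnd : seq (schedule n m)) (act : seq (node m)) : Prop :=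
  exists2 S, best_of fnd S &
    forall u, u \in act -> makespan q S / LB u <= 1 + eps.

Definition discarded (fnd : seq (schedule n m)) (gen : seq (node m)) u : Prop :=
  [\/ exists2 S, S \in fnd & makespan q S < LB u,
      exists i, 2 * (1 + eps) ^+ 2 < overhead R p u i |
      exists2 w, w \in gen & size w = size u /\ eps_equivalent eps p u w].

Definition add_child (fnd : seq (schedule n m))
    (ag : seq (node m) * seq (node m)) u : seq (node m) * seq (node m) :=
  (if `[< discarded fnd ag.2 u >] then ag.1 else rcons ag.1 u, rcons ag.2 u).

Definition branch (fnd : seq (schedule n m)) s v : state n m :=
  let ag := foldl (add_child fnd)
                  (filter (predC1 v) (active s), generated s)
                  [seq rcons v i | i <- enum 'I_m] in
  State ag.1 ag.2 fnd (processed s).+1.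

(* Every choice left open (ties in the selection, the vertex, the matching,
   ties between best schedules) is nondeterministic. *)
Inductive step : state n m -> config n m -> Prop :=
  | step_terminate s S :
      gap_closed (found s) (active s) -> best_of (found s) S ->
      step s (Returned S (processed s))
  (* The vertex found while bounding is integral: the algorithm stops on the
     spot, and v does not count as processed (otherwise, for m = 1, the root
     alone would exceed the bound 2 * m ^ (f eps + 1) / eps when eps > 2). *)
  | step_integral s v (x : {ffun unfixed n v * 'I_m -> R}) S0 S :
      ~ gap_closed (found s) (active s) -> selected (active s) v ->
      bounding_vertex p x -> integral x ->
      matching_schedule x S0 -> best_of (S0 :: found s) S ->
      step s (Returned S (processed s))
  | step_bounded s v (x : {ffun unfixed n v * 'I_m -> R}) S0 S :
      ~ gap_closed (found s) (active s) -> selected (active s) v ->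
      bounding_vertex p x -> ~ integral x ->
      matching_schedule x S0 ->
      gap_closed (S0 :: found s) (active s) -> best_of (S0 :: found s) S ->
      step s (Returned S (processed s).+1)
  | step_branch s v (x : {ffun unfixed n v * 'I_m -> R}) S0 :
      ~ gap_closed (found s) (active s) -> selected (active s) v ->
      bounding_vertex p x -> ~ integral x ->
      matching_schedule x S0 ->
      ~ gap_closed (S0 :: found s) (active s) ->
      step s (Running (branch (S0 :: found s) s v)).

(* Total correctness: no run from the given configuration gets stuck or goes on
   forever, and each one returns S after processing N nodes with Q S N. *)
Inductive returns (Q : schedule n m -> nat -> Prop) : config n m -> Prop :=
  | returns_done S N : Q S N -> returns Q (Returned S N)
  | returns_step s :
      (exists c, step s c) -> (forall c, step s c -> returns Q c) ->
      returns Q (Running s).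

Definition initial : config n m := Running (State [:: [::]] [:: [::]] [::] 0).

End Algorithm.

(* The jobs are first sorted by some permutation s; the schedule computed for
   the sorted instance is translated back to the original numbering. *)
Definition A_eq_prof_returns (R : realType) (n m : nat) (eps : R)
    (p : 'I_n -> nat) (Q : schedule n m -> nat -> Prop) : Prop :=
  forall s : {perm 'I_n},
    (forall i j : 'I_n, (i <= j)%N -> (p (s j) <= p (s i))%N) ->
    returns eps (fun j => p (s j))
      (fun S N => Q [ffun j => S ((s^-1)%g j)] N)
      (initial n m).

(* Main.v *)
Require Import Defs.
From mathcomp Require Import all_boot all_order all_algebra all_fingroup.
From mathcomp Require Import boolp classical_sets reals.
From mathcomp Require Import lra ring.

Set Implicit Arguments.
Unset Strict Implicit.
Unset Printing Implicit Defensive.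

Import Order.TTheory GRing.Theory Num.Theory.
Local Open Scope classical_set_scope.
Local Open Scope ring_scope.

(* Let opt be the optimal makespan, in scaled units at most 2.

   Correctness.  Rounding the big jobs down loses a factor 1 + eps, so a node
   whose profile is that of the restriction of an optimal schedule to the fixed
   jobs can be completed with makespan at most (1 + eps) opt; in particular its
   lower bound is at most (1 + eps) opt.  Such a node is always active, unless
   a schedule of makespan at most (1 + eps) opt has been found: when its child
   following the optimal schedule is discarded because of an equivalent node,
   that node has the same profile.  The stopping rule costs a second factor
   1 + eps.

   Node count.  Once all big jobs are fixed, the matching adds at most one
   small job per machine, so the makespan exceeds the lower bound, which is at
   least 1, by at most eps and the gap closes.  As the scaled jobs have total
   length at most m, at most m / eps of them are big, which bounds the depth;
   at each depth the opened nodes have distinct profiles, hence there are at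
   most (m + 1) ^ g of them for the number g of possible rounded loads.

   Vertices.  Moving along a line inside a polytope until a constraint becomes
   tight shows that each point can be replaced by a vertex with the same tight
   constraints; this yields a vertex that splits the longest unfixed job unless
   an integral one exists. *)

(** * Vertices of assignment polytopes *)

(** A nonzero maximal minor has a nonzero term in its Leibniz expansion, and the permutation of that
    term picks the columns. *)
Lemma row_free_transversal (F : fieldType) k l (A : 'M[F]_(k, l)) :
  row_free A -> exists2 g : 'I_k -> 'I_l, injective g & forall a, A a (g a) != 0.
Proof.
move=> freeA; have fullA : row_full A^T by rewrite /row_full mxrank_tr.
pose f := fullrankfun fullA.
have : \det (rowsub f A^T) != 0.
  by rewrite -unitfE -unitmxE fullrowsub_unit.
have [[s /= s_neq0] _|] := pselect (exists s : 'S_k, \prod_i A (s i) (f i) != 0).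
  exists (fun a => f ((s^-1)%g a)) => [a b /fullrankfun_inj /perm_inj //|a].
  move/prodf_neq0: s_neq0 => /(_ ((s^-1)%g a) isT).
  by rewrite permKV.
move=> noS; rewrite /determinant big1 ?eqxx // => s _.
have /negP/negPn/eqP prod0 : ~ (\prod_i A (s i) (f i) != 0) by move=> ?; case: noS; exists s.
rewrite (eq_bigr (fun i => A (s i) (f i))) ?prod0 ?mulr0 //.
by move=> i _; rewrite !mxE.
Qed.

(** The step is the least ratio [g k / - d k] over the decreasing coordinates, so the minimizer is
    the first to reach 0. *)
Lemma ray_exit (R : realFieldType) (K : finType) (g d : K -> R) :
    (forall k, 0 <= g k) -> (exists k, d k < 0) ->
  exists2 t, (forall k, 0 <= g k + t * d k) & exists2 k, d k < 0 & g k + t * d k = 0.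
Proof.
move=> g_ge0 [k0 dk0]; pose r k := g k / - d k.
case: (@arg_minP _ _ _ k0 (fun k => d k < 0) r dk0) => k dk rmin.
have r_ge0 : 0 <= r k by rewrite divr_ge0 // oppr_ge0 ltW.
exists (r k) => [l|]; last first.
  by exists k; rewrite // /r invrN mulrN mulNr divfK ?subrr ?lt_eqF.
have [dl|dl] := ltP (d l) 0; last by apply: addr_ge0; [exact: g_ge0 | exact: mulr_ge0].
have := rmin _ dl; rewrite {2}/r ler_pdivlMr ?oppr_gt0 //.
by rewrite mulrN lerNl -subr_ge0 opprK addrC.
Qed.

Section AssignmentPolytope.
Context (R : realType) (J : finType) (m : nat) (p : J -> R) (c : 'I_m -> R).
Implicit Types (x y z d : {ffun J * 'I_m -> R}).

Definition assignment_polytope : set {ffun J * 'I_m -> R} :=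
  [set x | [/\ forall j i, 0 <= x (j, i),
               forall j, \sum_i x (j, i) = 1 &
               forall i, \sum_j p j * x (j, i) <= c i]].

Lemma polytope_le1 x j i : assignment_polytope x -> x (j, i) <= 1.
Proof.
case=> x_ge0 /(_ j) <- _; rewrite (bigD1 i) //= lerDl sumr_ge0 //.
Qed.

(** All inequality constraints under one finite index type; the job equations, tight at every point,
    are kept apart. *)
Definition slack x (k : J * 'I_m + 'I_m) : R :=
  match k with
  | inl ji => x ji
  | inr i => c i - \sum_j p j * x (j, i)
  end.

Lemma slack_ge0P x :
  assignment_polytope x <->
  (forall k, 0 <= slack x k) /\ (forall j, \sum_i x (j, i) = 1).
Proof.
split=> [[x_ge0 sum1 load]|[s_ge0 sum1]].
  by split=> // -[[j i]|i] /=; rewrite ?subr_ge0.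
split=> // [j i|i]; first exact: (s_ge0 (inl (j, i))).
by have := s_ge0 (inr i); rewrite /= subr_ge0.
Qed.

Lemma slack_comb x y z (a b : R) : a + b = 1 ->
    (forall e, x e = a * y e + b * z e) ->
  forall k, slack x k = a * slack y k + b * slack z k.
Proof.
move=> ab1 xE [e|i] /=; first exact: xE.
rewrite (eq_bigr (fun j => a * (p j * y (j, i)) + b * (p j * z (j, i)))); last first.
  by move=> j _; rewrite xE; ring.
rewrite big_split /= -!mulr_sumr -[c i in LHS]mul1r -ab1; ring.
Qed.

(** For points of the polytope: [y] lies in the smallest face containing [x]. *)
Definition tighter x y := forall k, slack x k = 0 -> slack y k = 0.

Lemma comb_tighter x y z (a : R) :
    assignment_polytope y -> assignment_polytope z -> 0 < a < 1 ->
    (forall e, x e = a * y e + (1 - a) * z e) -> tighter x y /\ tighter x z.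
Proof.
move=> /slack_ge0P[y_ge0 _] /slack_ge0P[z_ge0 _] /andP[a_gt0 a_lt1] xE.
have b_gt0 : 0 < 1 - a by rewrite subr_gt0.
have both k : slack x k = 0 -> slack y k = 0 /\ slack z k = 0.
  rewrite (@slack_comb x y z a (1 - a)) ?subrKC // => /eqP.
  rewrite paddr_eq0 ?mulr_ge0 // ?ltW // !mulf_eq0 (gt_eqF a_gt0) (gt_eqF b_gt0) /=.
  by case/andP=> /eqP ? /eqP ?.
by split=> k /both[].
Qed.

(** Induction on the number of constraints that are not tight. A point inside a segment from [y] to
    [z] can move along [y - z], which keeps tight constraints tight, until one more becomes
    tight. *)
Lemma exists_tighter_vertex x : assignment_polytope x ->
  exists2 y, is_vertex assignment_polytope y & tighter x y.
Proof.
have [N] := ubnP #|[pred k | slack x k != 0]|.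
elim: N => // N IHN in x * => ltN Qx.
have [vx|nvx] := pselect (is_vertex assignment_polytope x); first by exists x.
have [y [z [a [Qy Qz a01 xE yNz]]]] : exists y z a,
    [/\ assignment_polytope y, assignment_polytope z, 0 < a < 1,
        forall e, x e = a * y e + (1 - a) * z e & y <> z].
  apply: contrapT => nex; apply: nvx; split=> // y z a Qy Qz a01 xE.
  by apply: contrapT => yNz; apply: nex; exists y, z, a.
have [ty tz] := comb_tighter Qy Qz a01 xE.
have [xs_ge0 x_sum1] := (slack_ge0P x).1 Qx.
have [_ y_sum1] := (slack_ge0P y).1 Qy.
have [_ z_sum1] := (slack_ge0P z).1 Qz.
pose d k := slack y k - slack z k.
(* The rows of [y] and [z] have equal sums, so a difference without negative coordinates would
   vanish. *)
have d_lt0 : exists k, d k < 0.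
  apply: contrapT => nd; apply: yNz; apply/ffunP => -[j i].
  have d_ge0 i' : 0 <= y (j, i') - z (j, i').
    by rewrite leNgt; apply/negP => dlt; apply: nd; exists (inl (j, i')).
  apply/eqP; rewrite -subr_eq0; apply/eqP.
  have /eqP : \sum_i' (y (j, i') - z (j, i')) = 0 by rewrite sumrB y_sum1 z_sum1 subrr.
  by rewrite psumr_eq0 // => /allP/(_ i (mem_index_enum i))/eqP.
have [t xt_ge0 [k0 dk0 xtk0]] := ray_exit xs_ge0 d_lt0.
pose xt : {ffun J * 'I_m -> R} := [ffun e => x e + t * (y e - z e)].
have slack_xt k : slack xt k = slack x k + t * d k.
  case: k => [e|i]; first by rewrite /= ffunE.
  rewrite /d /=.
  rewrite (eq_bigr (fun j => p j * x (j, i) + t * (p j * y (j, i) - p j * z (j, i)))); last first.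
    by move=> j _; rewrite ffunE; ring.
  rewrite big_split /= -mulr_sumr sumrB; ring.
have txt : tighter x xt.
  by move=> k xk0; rewrite slack_xt /d (ty _ xk0) (tz _ xk0) xk0 subrr mulr0 addr0.
have Qxt : assignment_polytope xt.
  apply/slack_ge0P; split=> [k|j]; first by rewrite slack_xt.
  rewrite (eq_bigr (fun i => x (j, i) + t * (y (j, i) - z (j, i)))).
    by rewrite big_split /= -mulr_sumr sumrB x_sum1 y_sum1 z_sum1 subrr mulr0 addr0.
  by move=> i _; rewrite ffunE.
case: (IHN xt _ Qxt) => [|w vw tw]; last by exists w => // k /txt /tw.
rewrite ltnS in ltN; apply: leq_trans ltN; apply: proper_card; apply/properP; split.
  by apply/fintype.subsetP => k; rewrite !inE; apply: contraNN => /eqP /txt ->.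
exists k0; rewrite !inE ?slack_xt ?xtk0 ?eqxx //.
apply/eqP => xk0; move: dk0; rewrite /d (ty _ xk0) (tz _ xk0) subrr ltxx //.
Qed.

(** The zeros of the 0/1 point of [f] are tight constraints, so a tighter vertex still puts each job
    on [f j] alone. *)
Lemma integral_vertex (f : J -> 'I_m) :
    (forall i, \sum_(j | f j == i) p j <= c i) ->
  exists2 x, is_vertex assignment_polytope x & forall j i, x (j, i) \is a Num.int.
Proof.
move=> f_le; pose x : {ffun J * 'I_m -> R} := [ffun e => (f e.1 == e.2)%:R].
have Qx : assignment_polytope x.
  split=> [j i|j|i]; first by rewrite ffunE ler0n.
    rewrite (bigD1 (f j)) //= ffunE eqxx big1 ?addr0 // => i /negPf.
    by rewrite ffunE eq_sym => /= ->.
  apply: le_trans (f_le i); rewrite [leRHS]big_mkcond; apply: ler_sum => j _.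
  by rewrite ffunE /=; case: eqP; rewrite ?mulr1 ?mulr0.
have [y vy ty] := exists_tighter_vertex Qx; exists y => // j i.
have y0 i' : i' != f j -> y (j, i') = 0.
  move=> /negPf ne; apply: (ty (inl (j, i'))).
  by rewrite /= ffunE /= eq_sym ne.
have [->|/y0 ->] := eqVneq i (f j); last by rewrite rpred0.
case: vy => [[_ /(_ j) + _] _]; rewrite (bigD1 (f j)) //= big1 ?addr0 //.
by move->; rewrite rpred1.
Qed.

(** A nonzero [d], once scaled down, would make [x] the midpoint of two distinct points of the
    polytope. *)
Lemma vertex_no_circulation x d : is_vertex assignment_polytope x ->
    (forall e, x e = 0 -> d e = 0) -> (forall j, \sum_i d (j, i) = 0) ->
    (forall i, \sum_j p j * d (j, i) = 0) ->
  forall e, d e = 0.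
Proof.
case=> Qx extr d_supp d_sum d_load.
(* Chosen so that [|d e| / M <= x e], which keeps both points nonnegative; where [x e] is 0, so is
   [d e]. *)
pose M := 1 + \sum_e `|d e| / x e.
have x_ge0 e : 0 <= x e by case: e => j i; case: Qx.
have s_ge0 e : 0 <= `|d e| / x e by rewrite divr_ge0.
have M_gt0 : 0 < M by rewrite ltr_pwDl // sumr_ge0.
have d_le e : `|M^-1 * d e| <= x e.
  rewrite normrM gtr0_norm ?invr_gt0 // mulrC ler_pdivrMr //.
  have [x0|xN0] := eqVneq (x e) 0; first by rewrite d_supp // normr0 x0 mul0r.
  have x_gt0 : 0 < x e by rewrite lt_def xN0 x_ge0.
  rewrite mulrC -ler_pdivrMr // /M (bigD1 e) //= addrCA lerDl.
  by rewrite addr_ge0 // sumr_ge0.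
have Qt t : `|t| <= 1 -> assignment_polytope [ffun e => x e + t * (M^-1 * d e)].
  move=> t1; case: (Qx) => _ x_sum x_load; split=> [j i|j|i].
  - rewrite ffunE -lerBlDr sub0r.
    apply: le_trans (ler_norm _) _; rewrite normrN; apply: le_trans (d_le (j, i)).
    by rewrite normrM ler_piMl.
  - under eq_bigr do rewrite ffunE.
    by rewrite big_split /= -!mulr_sumr d_sum !mulr0 addr0.
  - rewrite (eq_bigr (fun j => p j * x (j, i) + t * (M^-1 * (p j * d (j, i))))).
      by rewrite big_split /= -!mulr_sumr d_load !mulr0 addr0.
    by move=> j _; rewrite ffunE; ring.
have half : 0 < (2^-1 : R) < 1 by lra.
have N1 : `|-1 : R| <= 1 by rewrite normrN1.
have P1 : `|1 : R| <= 1 by rewrite normr1.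
have /ffunP eqd := extr _ _ _ (Qt _ P1) (Qt _ N1) half (fun e => ltac:(rewrite !ffunE; lra)).
move=> e; have := eqd e; rewrite !ffunE => h.
have /eqP : M^-1 * d e = 0 by lra.
by rewrite mulf_eq0 invr_eq0 (gt_eqF M_gt0) /= => /eqP.
Qed.

End AssignmentPolytope.

(** Jobs are placed from the end of the list: [s2] holds those already assigned when [j] is
    considered. *)
Lemma greedy_assignment (R : numDomainType) (J : finType) (m : nat) (p : J -> R)
    (c : 'I_m -> R) :
    (0 < m)%N -> (forall i, 0 <= c i) ->
    forall s : seq J, uniq s ->
    (forall (f : J -> 'I_m) s1 j s2, s = s1 ++ j :: s2 ->
       (forall i, \sum_(k <- s2 | f k == i) p k <= c i) ->
       exists i, \sum_(k <- s2 | f k == i) p k + p j <= c i) ->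
  exists f : J -> 'I_m, forall i, \sum_(k <- s | f k == i) p k <= c i.
Proof.
move=> m_gt0 c_ge0; elim=> [_ _|j s IHs /= /andP[jNs uniq_s] place].
  by exists (fun=> Ordinal m_gt0) => i; rewrite big_nil.
have [|f f_le] := IHs uniq_s.
  by move=> f s1 k s2 sE; apply: (place f (j :: s1)); rewrite sE.
have [i1 i1_le] := place f [::] j s erefl f_le.
exists (fun k => if k == j then i1 else f k) => i.
have tailE : \sum_(k <- s | (if k == j then i1 else f k) == i) p k
    = \sum_(k <- s | f k == i) p k.
  rewrite big_seq_cond [RHS]big_seq_cond; apply: eq_bigl => k /=.
  by have [->|//] := eqVneq k j; rewrite (negPf jNs).
rewrite big_cons eqxx tailE; case: eqP => [<-|//].
by rewrite addrC.
Qed.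

(** * Vertices splitting the longest job, and matchings at vertices *)

Section AssignmentVertices.
Context (R : realType) (J : finType) (m : nat) (p : J -> R) (c : 'I_m -> R).
Hypotheses (m_gt0 : (0 < m)%N) (p_ge0 : forall j, 0 <= p j).
Implicit Types (x : {ffun J * 'I_m -> R}).

Local Notation Q := (assignment_polytope p c).

Section Capacities.
Hypotheses (c_ge0 : forall i, 0 <= c i) (total_le : \sum_j p j <= \sum_i c i).

(** Machine [i0] is filled with [A] and a fraction [theta] of [j0]; the remaining work is spread
    over the other machines in proportion to their capacities. The constraints tight there force a
    tighter vertex to put the same fraction of [j0] on [i0]. *)
Lemma split_vertex (j0 : J) (i0 : 'I_m) (A : pred J) : ~~ A j0 ->
    \sum_(j | A j) p j < c i0 < \sum_(j | A j) p j + p j0 ->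
  exists2 x, is_vertex Q x & x (j0, i0) \isn't a Num.int.
Proof.
move=> Aj0 /andP[gtA ltAj0].
set a := \sum_(j | A j) p j in gtA ltAj0.
have p0_gt0 : 0 < p j0 by rewrite -(ltrD2l a) addr0 (lt_trans gtA).
pose theta := (c i0 - a) / p j0.
have theta01 : 0 < theta < 1.
  by rewrite divr_gt0 ?subr_gt0 //= ltr_pdivrMr // mul1r ltrBlDl.
pose done j : R := if A j then 1 else if j == j0 then theta else 0.
have done01 j : 0 <= done j <= 1.
  rewrite /done; case: ifP => _; first by rewrite ler01 lexx.
  by case: ifP => _; rewrite ?lexx ?ler01 //; case/andP: theta01 => /ltW-> /ltW->.
have load_i0 (w : J -> R) : (forall j, A j -> w j = 1) ->
    (forall j, ~~ A j -> j != j0 -> w j = 0) -> \sum_j p j * w j = a + p j0 * w j0.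
  move=> w1 w0; rewrite (bigID A) /=; congr (_ + _).
    by apply: eq_bigr => j /w1 ->; rewrite mulr1.
  rewrite (bigD1 j0) //= big1 ?addr0 // => j /andP[/w0 + jN]; move/(_ jN) ->.
  exact: mulr0.
have done_load : \sum_j p j * done j = c i0.
  rewrite load_i0; last 2 first.
  - by move=> j Aj; rewrite /done Aj.
  - by move=> j Aj jN; rewrite /done (negPf Aj) (negPf jN).
  by rewrite /done (negPf Aj0) eqxx /theta mulrC divfK ?gt_eqF // addrC subrK.
pose W := \sum_j p j * (1 - done j); pose C := \sum_(i | i != i0) c i.
have W_le : W <= C.
  rewrite /W (eq_bigr (fun j => p j - p j * done j)); last by move=> j _; rewrite mulrBr mulr1.
  rewrite sumrB done_load lerBlDl.
  by apply: le_trans total_le _; rewrite (bigD1 i0).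
(* Makes [C] positive, so that the proportions [c i / C] sum to 1. *)
have W_gt0 : 0 < W.
  apply: lt_le_trans (_ : p j0 * (1 - done j0) <= _).
    by rewrite mulr_gt0 // /done (negPf Aj0) eqxx subr_gt0; case/andP: theta01.
  rewrite /W (bigD1 j0) //= lerDl sumr_ge0 // => j _.
  by rewrite mulr_ge0 // subr_ge0; case/andP: (done01 j).
have C_gt0 : 0 < C by apply: lt_le_trans W_le.
pose x : {ffun J * 'I_m -> R} :=
  [ffun e => if e.2 == i0 then done e.1 else (1 - done e.1) * (c e.2 / C)].
have Qx : Q x.
  split=> [j i|j|i]; rewrite ?ffunE /=.
  - have /andP[d0 d1] := done01 j.
    by case: eqP => // _; rewrite mulr_ge0 ?subr_ge0 // divr_ge0 // ltW.
  - rewrite (bigD1 i0) //= ffunE eqxx (eq_bigr (fun i => (1 - done j) * (c i / C))).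
      by rewrite -mulr_sumr -mulr_suml -/C divff ?gt_eqF // mulr1 addrC subrK.
    by move=> i /negPf iN; rewrite ffunE /= iN.
  - under eq_bigr do rewrite ffunE /=.
    have [->|iN] := eqVneq i i0; first by rewrite done_load.
    under eq_bigr do rewrite mulrA.
    rewrite -mulr_suml -/W mulrCA ler_piMr // ler_pdivrMr // mul1r //.
have [y vy ty] := exists_tighter_vertex Qx; exists y => //.
have [[y_ge0 y_sum _] _] := vy.
have yA j : A j -> y (j, i0) = 1.
  move=> Aj; rewrite -(y_sum j) (bigD1 i0) //= big1 ?addr0 // => i /negPf iN.
  by apply: (ty (inl (j, i))); rewrite /= ffunE /= iN /done Aj subrr mul0r.
have y0 j : ~~ A j -> j != j0 -> y (j, i0) = 0.
  move=> Aj jN; apply: (ty (inl (j, i0))).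
  by rewrite /= ffunE /= eqxx /done (negPf Aj) (negPf jN).
have : \sum_j p j * y (j, i0) = c i0.
  apply/eqP; rewrite -subr_eq0 -oppr_eq0 opprB; apply/eqP.
  apply: (ty (inr i0)); rewrite /=.
  by under eq_bigr do rewrite ffunE /= eqxx; rewrite done_load subrr.
rewrite load_i0 // => /(canRL (addKr a)); rewrite addrC => y_load.
have -> : y (j0, i0) = theta by rewrite /theta -y_load mulrC mulKf ?gt_eqF.
case/andP: theta01 => th0 th1; apply/negP => /intrP[z zE].
by move: th0 th1; rewrite zE ltr0z ltrz1; case: z {zE} => [[|]|].
Qed.

(* Unless some machine can be filled up by other jobs and a proper part of j0,
   every machine that rejects a job in the greedy assignment is exactly full:
   it would otherwise have been filled up by a part of j0, which is longer. *)
Lemma exists_split_or_integral_vertex (j0 : J) : (forall j, p j <= p j0) ->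
  exists2 x, is_vertex Q x &
    (forall j i, x (j, i) \is a Num.int) \/ exists i, x (j0, i) \isn't a Num.int.
Proof.
move=> longest.
have [[i [A [Aj0 splitA]]]|noSplit] := pselect (exists i (A : pred J), ~~ A j0 /\
    \sum_(j | A j) p j < c i < \sum_(j | A j) p j + p j0).
  by have [x vx xN] := split_vertex Aj0 splitA; exists x => //; right; exists i.
(* Heading the list, [j0] is placed last, so no tail [s2] contains it. *)
pose s := j0 :: [seq j <- index_enum J | j != j0].
have uniq_s : uniq s by rewrite /= mem_filter eqxx /= filter_uniq ?index_enum_uniq.
have mem_s j : j \in s by rewrite inE mem_filter mem_index_enum andbT orbN.
have sum_s (P : pred J) F : \sum_(j <- s | P j) F j = \sum_(j | P j) F j :> R.
  apply: perm_big; apply: uniq_perm => //; first exact: index_enum_uniq.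
  by move=> j; rewrite mem_s mem_index_enum.
suff [f f_le] : exists f : J -> 'I_m, forall i, \sum_(k <- s | f k == i) p k <= c i.
  have [|x vx xint] := @integral_vertex R J m p c f; last by exists x => //; left.
  by move=> i; rewrite -sum_s.
apply: greedy_assignment => // f s1 j s2 sE f_le.
apply: contrapT => noRoom.
have over i : c i < \sum_(k <- s2 | f k == i) p k + p j.
  by rewrite ltNge; apply/negP => room; apply: noRoom; exists i.
have uniq_s2 : uniq (j :: s2) by move: uniq_s; rewrite sE cat_uniq => /and3P[].
have j0Ns2 : j0 \notin s2.
  move: sE uniq_s; rewrite /s; case: s1 => [[-> _]|k s1 [_ ->]].
    by have /= /andP[] := uniq_s2.
  by rewrite /= mem_cat inE => /andP[/norP[_ /norP[]]].
have sum_s2 i : \sum_(k <- s2 | f k == i) p k = \sum_(k | (k \in s2) && (f k == i)) p k.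
  rewrite -big_filter -[RHS]sum_s -[RHS]big_filter; apply: perm_big.
  apply: uniq_perm; rewrite ?filter_uniq //; first by case/andP: uniq_s2.
  by move=> k; rewrite !mem_filter mem_s andbT andbC.
have full i : \sum_(k <- s2 | f k == i) p k = c i.
  apply/eqP; rewrite eq_le f_le leNgt; apply/negP => lt_c.
  apply: noSplit; exists i, (fun k => (k \in s2) && (f k == i)); split.
    by rewrite (negPf j0Ns2).
  rewrite -sum_s2 lt_c /=; apply: lt_le_trans (over i) _.
  by rewrite lerD2l.
have sum_full : \sum_(k <- s2) p k = \sum_i c i.
  by rewrite (partition_big f xpredT) //=; apply: eq_bigr => i _; rewrite -full.
(* The jobs of [s2] already use up the total capacity, which bounds the sum of all jobs. *)
have : p j <= 0.
  have s1_ge0 : 0 <= \sum_(k <- s1) p k by rewrite sumr_ge0.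
  move: total_le; rewrite -sum_s sE big_cat big_cons /= sum_full.
  by move: s1_ge0; lra.
move=> pj; have := over (Ordinal m_gt0).
by rewrite full ltrDl ltNge pj.
Qed.

End Capacities.

Definition is_fractional x j := exists i, x (j, i) \isn't a Num.int.

Lemma polytope_support x j : Q x -> exists i, 0 < x (j, i).
Proof.
case=> x_ge0 /(_ j) sum1 _; apply: contrapT => nopos.
move: sum1; rewrite big1; first by move=> /eqP; rewrite eq_sym oner_eq0.
move=> i _; apply/eqP; rewrite eq_le x_ge0 leNgt andbT.
by apply/negP => pos; apply: nopos; exists i.
Qed.

Lemma pos_int_eq1 x j i : Q x -> x (j, i) \is a Num.int -> 0 < x (j, i) -> x (j, i) = 1.
Proof.
move=> Qx /intrP[z xE]; have := polytope_le1 j i Qx.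
by rewrite xE ltr0z lerz1; case: z {xE} => [[|[|]]|].
Qed.

Lemma fractional_two_machines x j : Q x -> is_fractional x j ->
  exists i1 i2, [/\ i1 != i2, 0 < x (j, i1) & 0 < x (j, i2)].
Proof.
move=> Qx [i1 xN]; have [x_ge0 sum1 _] := Qx.
have x1 : 0 < x (j, i1).
  by rewrite lt_def x_ge0 andbT; apply: contraNneq xN => ->; rewrite rpred0.
have [i2 /andP[i21 x2]|no2] := pickP (fun i => (i != i1) && (0 < x (j, i))).
  by exists i1, i2; rewrite eq_sym.
move: xN; have -> : x (j, i1) = 1; last by rewrite rpred1.
rewrite -(sum1 j) (bigD1 i1) //= big1 ?addr0 // => i iN.
by apply/eqP; move: (no2 i); rewrite iN lt_def x_ge0 andbT /= => /negbFE.
Qed.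

(* A nonzero maximal minor of the edge-constraint incidence matrix of the
   support assigns distinct constraints to the edges.  Each job constraint
   takes only one of the at least two edges at a fractional job, so another
   of them is assigned to a machine. *)
Lemma vertex_matching x : is_vertex Q x ->
  exists S : J -> 'I_m, (forall j, 0 < x (j, S j)) /\
    forall j j', is_fractional x j -> is_fractional x j' -> S j = S j' -> j = j'.
Proof.
move=> vx; have [Qx _] := vx; have [x_ge0 _ _] := Qx.
pose inc (e : J * 'I_m) (k : J + 'I_m) : R :=
  match k with inl j => (e.1 == j)%:R | inr i => (e.2 == i)%:R * p e.1 end.
pose P := [pred e | 0 < x e].
pose A : 'M[R]_(#|P|, #|{: J + 'I_m}|) := \matrix_(a, b) inc (enum_val a) (enum_val b).
have freeA : row_free A.
  apply: inj_row_free => u uA0.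
  (* A vector in the left kernel, read as weights on the edges of the support, is a direction to
     which [vertex_no_circulation] applies. *)
  pose d : {ffun J * 'I_m -> R} := [ffun e => \sum_(a | enum_val a == e) u 0 a].
  have uA k : \sum_a u 0 a * inc (enum_val a) k = 0.
    have /matrixP/(_ 0 (enum_rank k)) := uA0.
    rewrite mxE [RHS]mxE => uAk; rewrite -[RHS]uAk; apply: eq_bigr => a _.
    by rewrite mxE enum_rankK.
  have sum_d (F : J * 'I_m -> R) :
      \sum_a u 0 a * F (enum_val a) = \sum_k \sum_i F (k, i) * d (k, i).
    rewrite (pair_bigA _ (fun k i => F (k, i) * d (k, i))) /=.
    rewrite (partition_big (fun a : 'I_#|P| => enum_val a) xpredT) //=.
    apply: eq_bigr => -[k i] _; rewrite ffunE mulr_sumr.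
    by apply: eq_bigr => a /eqP ->; rewrite mulrC.
  have d0 : forall e, d e = 0.
    apply: (vertex_no_circulation vx).
    - move=> e xe0; rewrite ffunE big1 // => a /eqP ae.
      by have := enum_valP a; rewrite ae inE xe0 ltxx.
    - move=> j; rewrite -[RHS](uA (inl j)) /= (sum_d (fun e => (e.1 == j)%:R)).
      rewrite (bigD1 j) //= [X in _ + X]big1 ?addr0.
        by apply: eq_bigr => i _; rewrite eqxx mul1r.
      by move=> k /negPf kN; rewrite big1 // => i _; rewrite kN mul0r.
    - move=> i; rewrite -[RHS](uA (inr i)) /= (sum_d (fun e => (e.2 == i)%:R * p e.1)).
      apply: eq_bigr => k _; rewrite (bigD1 i) //= eqxx mul1r big1 ?addr0 //.
      by move=> i' /negPf iN; rewrite iN !mul0r.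
  apply/rowP => a; rewrite mxE -(d0 (enum_val a)) ffunE (big_pred1 a) //.
  by move=> b; rewrite (inj_eq enum_val_inj).
have [g g_inj gN0] := row_free_transversal freeA.
have g_edge j i (xji : 0 < x (j, i)) : exists2 a, enum_val a = (j, i) &
    (enum_val (g a) = inl j) \/ (enum_val (g a) = inr i).
  exists (enum_rank_in (xji : (j, i) \in P) (j, i)).
    by rewrite enum_rankK_in.
  move: (gN0 (enum_rank_in (xji : (j, i) \in P) (j, i))).
  rewrite mxE enum_rankK_in //; case: (enum_val _) => [j'|i'] /=.
    by have [->|_] := eqVneq j j'; rewrite ?eqxx //; left.
  by have [->|_] := eqVneq i i'; rewrite ?mul0r ?eqxx //; right.
have matched j : exists i, 0 < x (j, i) /\ (is_fractional x j ->
    exists2 a, enum_val a = (j, i) & enum_val (g a) = inr i).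
  have [fr|nfr] := pselect (is_fractional x j); last first.
    by have [i xi] := polytope_support j Qx; exists i.
  have [i1 [i2 [i12 x1 x2]]] := fractional_two_machines Qx fr.
  have [a1 a1E [g1|g1]] := g_edge _ _ x1; last by exists i1; split=> // _; exists a1.
  have [a2 a2E [g2|g2]] := g_edge _ _ x2; last by exists i2; split=> // _; exists a2.
  have /g_inj a12 : g a1 = g a2 by apply: enum_val_inj; rewrite g1 g2.
  by move: i12; have := a1E; rewrite a12 a2E => -[->]; rewrite eqxx.
have [S SP] := choice matched; exists S; split=> [j|j j' fr fr' Sjj']; first by case: (SP j).
have [_ /(_ fr)[a aE ga]] := SP j; have [_ /(_ fr')[a' a'E ga']] := SP j'.
have /g_inj aa' : g a = g a' by apply: enum_val_inj; rewrite ga ga' Sjj'.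
by move: aE; rewrite aa' a'E => -[].
Qed.

(** An integral job on [i] has [x (j, i) = 1], so these jobs are paid for by the LP load; beyond
    them [i] receives at most one fractional job. *)
Lemma matching_load x (S : J -> 'I_m) (delta : R) i : Q x -> 0 <= delta ->
    (forall j, 0 < x (j, S j)) ->
    (forall j j', is_fractional x j -> is_fractional x j' -> S j = S j' -> j = j') ->
    (forall j, is_fractional x j -> p j <= delta) ->
  \sum_(j | S j == i) p j <= c i + delta.
Proof.
move=> Qx delta_ge0 S_supp S_inj frac_le; have [x_ge0 _ load] := Qx.
apply: le_trans (_ : \sum_(j | S j == i) p j * x (j, i)
    + \sum_(j | (S j == i) && `[< is_fractional x j >]) p j <= _).
  rewrite [X in _ <= _ + X]big_mkcondr /= -big_split /=.
  apply: ler_sum => j /eqP Sj; case: ifP => [_|/asboolP nfr].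
    by rewrite lerDr mulr_ge0.
  rewrite (pos_int_eq1 Qx) ?mulr1 ?addr0 // -?Sj //.
  by apply/negPn/negP => xN; apply: nfr; exists (S j).
apply: lerD.
  apply: le_trans (load i); rewrite [leLHS]big_mkcond; apply: ler_sum => j _.
  by case: ifP => _ //; rewrite mulr_ge0.
have [j /andP[/eqP Sj /asboolP fr]|no] := pickP (fun j => (S j == i) && `[< is_fractional x j >]).
  rewrite (big_pred1 j) ?frac_le // => k; apply/andP/eqP => [[/eqP Sk /asboolP frk]|->].
    by apply: S_inj => //; rewrite Sk.
  by rewrite Sj eqxx; split=> //; apply/asboolP.
by rewrite big_pred0.
Qed.

End AssignmentVertices.

(** * Lower bounds and matching schedules *)

Lemma partial_LP_polytope (R : realType) (J : finType) (m : nat) (P : J -> R)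
    (t : 'I_m -> R) (T : R) : (forall j, P j <= T) ->
  partial_LP (fun j _ => P j) t T = assignment_polytope P (fun i => T - t i).
Proof.
move=> P_le; apply/predeqP => x; split=> [[x_ge0 _ sum1 load]|[x_ge0 sum1 load]]; split=> //.
- by move=> j; rewrite -(sum1 j); apply: eq_bigl => i; rewrite P_le.
- move=> i; apply: le_trans (load i); rewrite le_eqVlt; apply/orP; left; apply/eqP.
  by apply: eq_bigl => j; rewrite P_le.
- by move=> j i; rewrite ltNge P_le.
- by move=> j; rewrite -(sum1 j); apply: eq_bigl => i; rewrite P_le.
- move=> i; apply: le_trans (load i); rewrite le_eqVlt; apply/orP; left; apply/eqP.
  by apply: eq_bigl => j; rewrite P_le.
Qed.

(** For sufficiency, spreading each job in proportion to the residual capacities [T - t i] respects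
    every capacity once the total does. *)
Lemma partial_LP_feasibleP (R : realType) (J : finType) (m : nat) (P : J -> R)
    (t : 'I_m -> R) (T : R) : (0 < m)%N -> (forall j, 0 <= P j) ->
  partial_LP (fun j _ => P j) t T !=set0 <->
  [/\ forall j, P j <= T, forall i, t i <= T & \sum_i t i + \sum_j P j <= T *+ m].
Proof.
move=> m_gt0 P_ge0.
have capE : \sum_i (T - t i) = T *+ m - \sum_i t i.
  by rewrite sumrB sumr_const card_ord.
split=> [[x LPx]|[P_le t_le total_le]].
  have P_le j : P j <= T.
    rewrite leNgt; apply/negP => ltP; case: LPx => _ _ /(_ j) + _.
    rewrite big_pred0; last by move=> i; rewrite leNgt ltP.
    by move=> /eqP; rewrite eq_sym oner_eq0.
  move: LPx; rewrite partial_LP_polytope // => -[x_ge0 sum1 load]; split=> //.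
    move=> i; rewrite -subr_ge0; apply: le_trans (load i).
    by rewrite sumr_ge0 // => j _; rewrite mulr_ge0.
  rewrite addrC -lerBrDr -capE.
  apply: le_trans (_ : \sum_i \sum_j P j * x (j, i) <= _); last exact: ler_sum.
  rewrite exchange_big /= ler_sum // => j _.
  by rewrite -mulr_sumr sum1 mulr1.
rewrite partial_LP_polytope //; pose C := \sum_i (T - t i).
have c_ge0 i : 0 <= T - t i by rewrite subr_ge0.
have P_le_C : \sum_j P j <= C by rewrite /C capE lerBrDr addrC.
have [C0|CN0] := eqVneq C 0; last first.
  exists [ffun e => (T - t e.2) / C]; split=> [j i|j|i].
  - by rewrite ffunE divr_ge0 // sumr_ge0.
  - rewrite (eq_bigr (fun i => (T - t i) / C)); last by move=> i _; rewrite ffunE.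
    by rewrite -mulr_suml divff.
  - rewrite (eq_bigr (fun j => P j * ((T - t i) / C))); last by move=> j _; rewrite ffunE.
    rewrite -mulr_suml mulrCA ler_piMr // ler_pdivrMr ?mul1r //.
    by rewrite lt_def CN0 sumr_ge0.
have P0 j : P j = 0.
  have : \sum_j P j == 0 by rewrite eq_le sumr_ge0 // andbT (le_trans P_le_C) // C0.
  by rewrite psumr_eq0 // => /allP/(_ j (mem_index_enum j))/eqP.
exists [ffun e => (e.2 == Ordinal m_gt0)%:R]; split=> [j i|j|i].
- by rewrite ffunE ler0n.
- rewrite (bigD1 (Ordinal m_gt0)) //= ffunE eqxx big1 ?addr0 // => i /negPf iN.
  by rewrite ffunE /= iN.
- by rewrite big1 ?subr_ge0 // => j _; rewrite P0 mul0r.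
Qed.

(** The feasible guesses form a closed half-line; hence the minimum defining [scale] is attained,
    and, after rounding up, so is [LB]. *)
Lemma partial_LP_threshold (R : realType) (J : finType) (m : nat) (P : J -> R)
    (t : 'I_m -> R) :
    (0 < m)%N -> (forall j, 0 <= P j) -> (forall i, 0 <= t i) ->
  exists2 tau : R, 0 <= tau &
    forall T, partial_LP (fun j _ => P j) t T !=set0 <-> tau <= T.
Proof.
move=> m_gt0 P_ge0 t_ge0.
exists (Num.max (\big[Num.max/0]_j P j)
  (Num.max (\big[Num.max/0]_i t i) ((\sum_i t i + \sum_j P j) / m%:R))).
  by rewrite le_max bigmax_ge_id.
move=> T; rewrite partial_LP_feasibleP // !ge_max.
rewrite ler_pdivrMr ?ltr0n // mulr_natr; split=> [[P_le t_le ->]|].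
  have T_ge0 : 0 <= T by apply: le_trans (t_ge0 (Ordinal m_gt0)) (t_le _).
  by rewrite !bigmax_le.
by case/and3P=> /bigmax_leP[_ P_le] /bigmax_leP[_ t_le] ?; split=> // ?; [exact: P_le|exact: t_le].
Qed.

Lemma smallestE (R : realType) (A : set R) a : A a -> lbound A a -> Defs.smallest A = a.
Proof.
move=> Aa lba; apply: xget_unique => // b [Ab lbb].
by apply: le_anti; rewrite lbb // lba.
Qed.

Section Makespan.
Context (R : realType) (n m : nat) (t : 'I_n -> R).
Implicit Types (S : {ffun 'I_n -> 'I_m}).

Lemma load_le_makespan S i : \sum_(j | S j == i) t j <= makespan t S.
Proof. exact: (le_bigmax _ (fun i => \sum_(j | S j == i) t j)). Qed.

Lemma makespan_ge0 S : 0 <= makespan t S.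
Proof. exact: bigmax_ge_id. Qed.

Lemma makespan_le S b : 0 <= b -> (forall i, \sum_(j | S j == i) t j <= b) ->
  makespan t S <= b.
Proof. by move=> b_ge0 load_le; apply: bigmax_le. Qed.

Lemma makespanZ S a : 0 <= a -> makespan (fun j => t j * a) S = makespan t S * a.
Proof.
move=> a_ge0; rewrite /makespan.
apply: (big_rec2 (fun x y => x = y * a)); first by rewrite mul0r.
by move=> i x y _ ->; rewrite maxr_pMl // mulr_suml.
Qed.

End Makespan.

(** * The scaled instance and its lower bounds *)

Section Instance.
Context (R : realType) (n m : nat) (p : 'I_n -> nat) (m_gt0 : (0 < m)%N).
Implicit Types (v : node m) (S : schedule n m).

Local Notation q := (@scaled R n m p).
Local Notation LB := (@LB R n m p).
Local Notation overhead := (@overhead R n m p).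
Local Notation scale := (@scale R n m p).

(** In effect, [scale] is the larger of the longest processing time and the average load. *)
Lemma scaleP : [/\ forall j, (p j)%:R <= scale, \sum_j (p j)%:R <= scale *+ m &
  forall T, 0 <= T -> (forall j, (p j)%:R <= T) -> \sum_j (p j)%:R <= T *+ m -> scale <= T].
Proof.
have p_ge0 (j : 'I_n) : 0 <= (p j)%:R :> R by rewrite ler0n.
have [//|tau tau_ge0 tauP] := @partial_LP_threshold R 'I_n m (fun j => (p j)%:R) (fun=> 0) m_gt0 p_ge0.
have -> : scale = tau.
  by apply: smallestE => [|T] /=; rewrite tauP.
have := (tauP tau).2 (lexx _); rewrite partial_LP_feasibleP //.
rewrite big1 // add0r => -[p_le _ sum_le]; split=> // T T_ge0 pT sumT.
by apply/tauP/partial_LP_feasibleP; rewrite // big1 // add0r.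
Qed.

Lemma scale_ge0 : 0 <= scale.
Proof.
have [_ h _] := scaleP; rewrite -(@pmulrn_lge0 _ _ m) //.
by apply: le_trans h; rewrite sumr_ge0 // => j _; rewrite ler0n.
Qed.

Lemma scaled_ge0 j : 0 <= q j.
Proof. by rewrite divr_ge0 ?ler0n ?scale_ge0. Qed.

(** This survives [scale = 0], since all processing times are then 0. *)
Lemma scaledK j : q j * scale = (p j)%:R.
Proof.
have [p_le _ _] := scaleP; rewrite /scaled.
have [s0|sN0] := eqVneq scale 0; last by rewrite divfK.
by rewrite s0 mulr0; apply: le_anti; rewrite ler0n -s0 p_le.
Qed.

Lemma scaled_eq0 : scale = 0 -> forall j, q j = 0.
Proof. by move=> s0 j; rewrite /scaled s0 invr0 mulr0. Qed.

Lemma scaled_le1 j : q j <= 1.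
Proof.
have [s0|sN0] := eqVneq scale 0; first by rewrite scaled_eq0 // ler01.
have s_gt0 : 0 < scale by rewrite lt_def sN0 scale_ge0.
by rewrite ler_pdivrMr // mul1r; case: scaleP.
Qed.

Lemma sum_scaled_le : \sum_j q j <= m%:R.
Proof.
have [s0|sN0] := eqVneq scale 0.
  by rewrite big1 ?ler0n // => j _; rewrite scaled_eq0.
have s_gt0 : 0 < scale by rewrite lt_def sN0 scale_ge0.
by rewrite -mulr_suml ler_pdivrMr // mulr_natl; case: scaleP.
Qed.

Lemma makespan_scaled S : makespan (fun j => (p j)%:R) S = makespan q S * scale.
Proof.
rewrite -makespanZ ?scale_ge0 //; congr (makespan _ S).
by apply/funext => j; rewrite scaledK.
Qed.

(** Makes every makespan an admissible integral guess for [LB]. *)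
Lemma makespan_int S : makespan q S * scale \is a Num.int.
Proof.
rewrite -makespan_scaled; apply: (big_ind (fun x : R => x \is a Num.int)).
- exact: rpred0.
- by move=> x y xint yint; rewrite /Num.max; case: ifP.
- by move=> i _; apply: rpred_sum => j _; apply: rpred_nat.
Qed.

Lemma overhead_ge0 v i : 0 <= overhead v i.
Proof. by rewrite sumr_ge0 // => j _; exact: scaled_ge0. Qed.

Lemma sum_unfixed v (P : pred 'I_n) (F : 'I_n -> R) :
  \sum_(j : unfixed n v | P (val j)) F (val j) = \sum_(j < n | (size v <= j)%N && P j) F j.
Proof. by rewrite -(big_sub_cond (fun j : 'I_n => size v <= j)%N P F). Qed.

Lemma sum_load v (S : schedule n m) i :
    (forall (j : 'I_n) i, onth v j = Some i -> S j = i) ->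
  \sum_(j | S j == i) q j = overhead v i + \sum_(j : unfixed n v | S (val j) == i) q (val j).
Proof.
move=> S_ext; rewrite (sum_unfixed v (fun j => S j == i)).
rewrite (bigID (fun j : 'I_n => (j < size v)%N)) /=; congr (_ + _); apply: eq_bigl => j.
  have [jv|vj] := ltnP j (size v); last by rewrite onth_default ?andbF.
  move: jv; rewrite -onthTE; case jE: onth => [k|] // _.
  by rewrite andbT (S_ext _ _ jE) (inj_eq Some_inj).
by rewrite -leqNgt andbC.
Qed.

Lemma sum_overhead v : \sum_i overhead v i + \sum_(j : unfixed n v) q (val j) = \sum_j q j.
Proof.
rewrite (sum_unfixed v xpredT) [RHS](bigID (fun j : 'I_n => (size v <= j)%N)) /= [LHS]addrC.
congr (_ + _); first by apply: eq_bigl => j; rewrite andbT.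
rewrite (partition_big (fun j : 'I_n => odflt (Ordinal m_gt0) (onth v j)) xpredT) //=.
apply: eq_bigr => i _; apply: eq_bigl => j.
by rewrite -onthNE; case: onth.
Qed.

Lemma node_LP_feasibleP v T : @node_LP R n m p v T !=set0 <->
  [/\ forall j : 'I_n, (size v <= j)%N -> q j <= T, forall i, overhead v i <= T
    & \sum_j q j <= T *+ m].
Proof.
rewrite partial_LP_feasibleP //; last by move=> j; exact: scaled_ge0.
rewrite sum_overhead; split=> -[q_le t_le total]; split=> // j.
  by move=> vj; exact: (q_le (exist _ j vj)).
by case: j => j vj /=; exact: q_le.
Qed.

(** The least guess is the feasibility threshold rounded up to a multiple of [1 / scale]; for
    [scale = 0] every guess counts as integral and the threshold itself serves. *)
Lemma LBP v : [/\ LB v * scale \is a Num.int, @node_LP R n m p v (LB v) !=set0 &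
  forall T, T * scale \is a Num.int -> @node_LP R n m p v T !=set0 -> LB v <= T].
Proof.
have [tau tau_ge0 tauP] := @partial_LP_threshold R _ m
  (fun j : unfixed n v => q (val j)) (overhead v) m_gt0
  (fun j => scaled_ge0 (val j)) (overhead_ge0 v).
suff [T [Tint tauT Tmin]] : exists T, [/\ T * scale \is a Num.int, tau <= T &
    forall T', T' * scale \is a Num.int -> tau <= T' -> T <= T'].
  have -> : LB v = T.
    by apply: smallestE => [|T' [T'int]]; rewrite /node_LP /= tauP // => /Tmin; apply.
  by split; rewrite /node_LP ?tauP // => T' T'int /tauP; exact: Tmin.
have [s0|sN0] := eqVneq scale 0.
  by exists tau; split=> //; rewrite s0 mulr0 rpred0.
have s_gt0 : 0 < scale by rewrite lt_def sN0 scale_ge0.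
exists ((Num.ceil (tau * scale))%:~R / scale); split.
- by rewrite divfK // rpred_int.
- by rewrite ler_pdivlMr // ceil_ge.
- move=> T' /intrP[z T'E] tauT'; rewrite ler_pdivrMr // T'E ler_int.
  by rewrite ceil_le_int -T'E ler_pM2r.
Qed.

Lemma node_LP_polytope v : @node_LP R n m p v (LB v) =
  assignment_polytope (fun j : unfixed n v => q (val j)) (fun i => LB v - overhead v i).
Proof.
apply: partial_LP_polytope => -[j vj] /=.
by have [_ /node_LP_feasibleP[q_le _ _] _] := LBP v; exact: q_le.
Qed.

Lemma sum_scaled_le_LB v : \sum_j q j <= LB v *+ m.
Proof. by have [_ /node_LP_feasibleP[]] := LBP v. Qed.

Lemma LB_ge0 v : 0 <= LB v.
Proof.
by rewrite -(@pmulrn_lge0 _ _ m) // (le_trans _ (sum_scaled_le_LB v)) // sumr_ge0 // => j _; exact: scaled_ge0.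
Qed.

(** [LB v * scale] is a feasible guess at the root, since the overheads bound the fixed jobs, and
    [scale] is the least such guess. *)
Lemma LB_ge1 v : 0 < scale -> 1 <= LB v.
Proof.
move=> s_gt0; rewrite -(ler_pM2r s_gt0) mul1r.
have [_ _ s_min] := scaleP; have [_ /node_LP_feasibleP[q_le t_le total] _] := LBP v.
have p_le j : (p j)%:R <= LB v * scale.
  rewrite -scaledK ler_pM2r //.
  have [/q_le //|jv] := leqP (size v) j.
  move: jv; rewrite -onthTE; case jE: onth => [i|] // _.
  apply: le_trans (t_le i); rewrite /overhead (bigD1 j) ?jE //= lerDl.
  by rewrite sumr_ge0 // => k _; exact: scaled_ge0.
apply: s_min => //; first by rewrite mulr_ge0 ?LB_ge0 // ltW.
rewrite (eq_bigr (fun j => q j * scale)); last by move=> j _; rewrite scaledK.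
by rewrite -mulr_suml -mulrnAl ler_pM2r.
Qed.

Lemma LB_le_makespan v S : (forall (j : 'I_n) i, onth v j = Some i -> S j = i) ->
  LB v <= makespan q S.
Proof.
move=> S_ext; have [_ _ Lmin] := LBP v; apply: Lmin; first exact: makespan_int.
apply/node_LP_feasibleP; split=> [j _|i|].
- apply: le_trans (load_le_makespan q S (S j)); rewrite (bigD1 j) //= lerDl.
  by rewrite sumr_ge0 // => k _; exact: scaled_ge0.
- apply: le_trans (load_le_makespan q S i); rewrite (sum_load i S_ext) lerDl.
  by rewrite sumr_ge0 // => k _; exact: scaled_ge0.
- have -> : makespan q S *+ m = \sum_(i < m) makespan q S by rewrite sumr_const card_ord.
  rewrite (partition_big S xpredT) //=.
  by apply: ler_sum => i _; exact: load_le_makespan.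
Qed.

(** List scheduling: if a job of length at most 1 fits on no machine, all machines are loaded beyond
    1 and the total exceeds [m]. *)
Lemma exists_schedule_le2 : exists S : schedule n m, makespan q S <= 2.
Proof.
have [|||f f_le] := @greedy_assignment R 'I_n m q (fun=> 2) m_gt0 _ (index_enum 'I_n).
- by move=> _; rewrite ler0n.
- exact: index_enum_uniq.
- move=> f s1 j s2 sE f_le; apply: contrapT => no.
  have over i : 1 <= \sum_(k <- s2 | f k == i) q k.
    rewrite leNgt; apply/negP => lt1; apply: no; exists i.
    by have := scaled_le1 j; move: lt1; lra.
  (* Were the total at most [m], the other machines, loaded at least 1 each, would leave the first
     one with load at most 1 and room for [j]. *)
  have : m%:R < \sum_(k <- s2) q k + q j.
    rewrite ltNge; apply/negP => le_m; apply: no; exists (Ordinal m_gt0).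
    apply: le_trans (_ : 1 + q j <= _); last by have := scaled_le1 j; lra.
    rewrite lerD2r; move: le_m; rewrite (partition_big f xpredT) //=.
    rewrite (bigD1 (Ordinal m_gt0)) //= -addrA => le_m.
    have : (m.-1)%:R <= \sum_(i < m | i != Ordinal m_gt0) \sum_(k <- s2 | f k == i) q k.
      apply: le_trans (_ : \sum_(i < m | i != Ordinal m_gt0) 1 <= _); last exact: ler_sum.
      by rewrite sumr_const cardC1 card_ord.
    have : m%:R = 1 + (m.-1)%:R :> R by rewrite -(prednK m_gt0) /= -natr1 addrC.
    by have := scaled_ge0 j; move: le_m; lra.
  rewrite ltNge => /negP; apply; apply: le_trans sum_scaled_le.
  rewrite [leRHS](_ : _ = \sum_(k <- s1) q k + (q j + \sum_(k <- s2) q k)); last first.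
    by rewrite sE big_cat big_cons.
  rewrite [leLHS]addrC lerDr sumr_ge0 // => k _; exact: scaled_ge0.
- exists [ffun j => f j]; apply: makespan_le => // i.
  apply: le_trans (f_le i); rewrite le_eqVlt; apply/orP; left; apply/eqP.
  by apply: eq_bigl => j; rewrite ffunE.
Qed.

(** Keeps runs from getting stuck when bounding. By sorting, the job of index [size v] is the
    longest unfixed one; at a leaf there is none and integrality is vacuous. *)
Lemma exists_bounding_vertex v :
    (forall i j : 'I_n, (i <= j)%N -> (p j <= p i)%N) ->
  exists x, @bounding_vertex R n m p v x.
Proof.
move=> p_sorted; rewrite /bounding_vertex node_LP_polytope.
have [_ /node_LP_feasibleP[q_le t_le total] _] := LBP v.
have q_ge0 (j : unfixed n v) : 0 <= q (val j) := scaled_ge0 (val j).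
have [vn|nv] := ltnP (size v) n.
  pose j0 : unfixed n v := exist _ (Ordinal vn) (leqnn (size v)).
  have [|||x vx xP] := exists_split_or_integral_vertex
      (c := fun i => LB v - overhead v i) m_gt0 q_ge0 _ _ (j0 := j0).
  - by move=> i; rewrite subr_ge0.
  - rewrite sumrB sumr_const card_ord lerBrDr addrC sum_overhead //.
  - by case=> j vj /=; rewrite ler_wpM2r ?invr_ge0 ?scale_ge0 // ler_nat p_sorted.
  exists x; split=> //; case: xP => [xint|xfr]; [by left|right].
  by move=> j jE; have -> : j = j0 by apply/val_inj/val_inj.
have noJ (j : unfixed n v) : False.
  by case: j => j vj; have := ltn_ord j; rewrite ltnNge (leq_trans nv vj).
have [|x vx xint] := @integral_vertex R (unfixed n v) m (fun j => q (val j))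
    (fun i => LB v - overhead v i) (fun=> Ordinal m_gt0).
  by move=> i; rewrite big1 ?subr_ge0 // => j; case: (noJ j).
by exists x; split=> //; left.
Qed.

Lemma exists_matching_schedule v x :
  is_vertex (@node_LP R n m p v (LB v)) x -> exists S : schedule n m, matching_schedule x S.
Proof.
rewrite node_LP_polytope => vx.
have [f [f_supp f_inj]] := vertex_matching vx.
pose S : schedule n m := [ffun j =>
  if insub j is Some u then f u else odflt (Ordinal m_gt0) (onth v j)].
have SE (u : unfixed n v) : S (val u) = f u by rewrite ffunE valK.
exists S; split=> [j i jE|u|u u' fr fr']; rewrite ?SE //; last exact: f_inj.
rewrite ffunE insubF ?jE //; apply/negbTE.
by rewrite -ltnNge -onthTE jE.
Qed.

(** Applied with [delta = 0] at an integral vertex and with [delta = eps] when only small jobs are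
    unfixed. *)
Lemma matching_schedule_makespan v x S (delta : R) :
    is_vertex (@node_LP R n m p v (LB v)) x -> matching_schedule x S -> 0 <= delta ->
    (forall j, fractional x j -> q (val j) <= delta) ->
  makespan q S <= LB v + delta.
Proof.
rewrite node_LP_polytope => -[Qx _] [S_ext S_supp S_inj] delta_ge0 fr_le.
apply: makespan_le => [|i]; first by rewrite addr_ge0 ?LB_ge0.
rewrite (sum_load i S_ext).
have := @matching_load R (unfixed n v) m (fun j => q (val j)) _
  (fun j => scaled_ge0 (val j)) x (fun j => S (val j)) delta i Qx delta_ge0 S_supp S_inj fr_le.
by rewrite /=; lra.
Qed.

End Instance.

(** * Rounding and profiles *)

Section Rounding.
Context (R : realType) (eps : R) (eps_gt0 : 0 < eps).

Lemma bernoulli k : 1 + k%:R * eps <= (1 + eps) ^+ k.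
Proof.
elim: k => [|k IHk]; first by rewrite mul0r addr0 expr0.
rewrite exprS; have k_ge0 : 0 <= k%:R :> R by rewrite ler0n.
have := ler_wpM2l (ltW (ltr_wpDl ler01 eps_gt0)) IHk.
apply: le_trans; rewrite -natr1.
have : 0 <= k%:R * eps * eps by rewrite !mulr_ge0 // ltW.
by lra.
Qed.

(** The supremum is attained, just before the first exponent whose power exceeds [x]. *)
Lemma roundP x : eps <= x -> exists k : nat,
  [/\ round eps x = eps * (1 + eps) ^+ k, eps * (1 + eps) ^+ k <= x
    & x < eps * (1 + eps) ^+ k.+1].
Proof.
move=> x_ge; have e1_ge1 : 1 <= 1 + eps by rewrite lerDl ltW.
have [|[|k] ltk kmin] := @ex_minnP (fun k => x < eps * (1 + eps) ^+ k).
(* Large enough by [bernoulli]: [1 + k * eps] already exceeds [x / eps]. *)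
- exists (Num.truncn (x / eps / eps)).+1.
  rewrite mulrC -ltr_pdivrMr //; apply: lt_le_trans (bernoulli _).
  by rewrite -ltrBlDl -ltr_pdivrMr // (le_lt_trans _ (truncnS_gt _)) // ler_pM2r ?invr_gt0 // gerBl.
- by move: ltk; rewrite expr0 mulr1 ltNge x_ge.
exists k; have lek : eps * (1 + eps) ^+ k <= x.
  by rewrite leNgt; apply/negP => /kmin; rewrite ltnn.
have ubx : ubound [set y | exists2 k : nat, y = eps * (1 + eps) ^+ k & y <= x]
    (eps * (1 + eps) ^+ k).
  move=> y /= [l -> ylx]; rewrite ler_pM2l // ler_weXn2l // leqNgt.
  apply/negP => kl; move: ltk; rewrite ltNge => /negP; apply.
  by apply: le_trans ylx; rewrite ler_pM2l // ler_weXn2l.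
split=> //; apply/le_anti/andP; split.
  by apply: ge_sup ubx; exists (eps * (1 + eps) ^+ k); exists k.
by apply: ub_le_sup; [exists (eps * (1 + eps) ^+ k) | exists k].
Qed.

Lemma round_le x : eps <= x -> round eps x <= x.
Proof. by case/roundP => k [->]. Qed.

Lemma le_round x : eps <= x -> x <= (1 + eps) * round eps x.
Proof. by case/roundP => k [-> _ /ltW]; rewrite exprS mulrCA. Qed.

(** By [bernoulli], [eps * (1 + eps) ^+ k <= 1] forces [k * eps <= 1 / eps]. *)
Definition exponent_bound : nat := (Num.truncn (eps^-1 / eps)).+1.
(** Bounds the number of big jobs, each at least [eps] long, under the overhead limit. *)
Definition multiplicity_bound : nat := Num.truncn (2 * (1 + eps) ^+ 2 / eps).
(** A rounded load is determined by how many of its jobs have each exponent. *)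
Definition multiplicities := {ffun 'I_exponent_bound -> 'I_multiplicity_bound.+1}.
Definition load_value (g : multiplicities) : R := \sum_k (g k)%:R * (eps * (1 + eps) ^+ k).

Lemma round_exponent x : eps <= x -> x <= 1 ->
  exists k : 'I_exponent_bound, round eps x = eps * (1 + eps) ^+ k.
Proof.
move=> /roundP[k [-> lek _]] x_le1.
have lt_k : (k < exponent_bound)%N.
  rewrite -(@ltr_nat R); apply: le_lt_trans (truncnS_gt _).
  rewrite ler_pdivlMr //.
  have pow_le : (1 + eps) ^+ k <= eps^-1.
    by rewrite -[leRHS]mul1r ler_pdivlMr // mulrC (le_trans lek).
  by apply: le_trans pow_le; apply: le_trans (bernoulli k); rewrite lerDr.
by exists (Ordinal lt_k).
Qed.

End Rounding.

(** * Counting profiles and comparing nodes with a schedule *)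

Section Profiles.
Context (R : realType) (n m : nat) (p : 'I_n -> nat) (m_gt0 : (0 < m)%N).
Context (eps : R) (eps_gt0 : 0 < eps).
Implicit Types (v w : node m) (S : schedule n m).

Local Notation q := (@scaled R n m p).
Local Notation LB := (@LB R n m p).
Local Notation overhead := (@overhead R n m p).
Local Notation scale := (@scale R n m p).
Local Notation big := (@big R n m eps p).
Local Notation rounded_load := (@rounded_load R n m eps p).
Local Notation q_ge0 := (scaled_ge0 R p m_gt0).
Local Notation limit := (2 * (1 + eps) ^+ 2).

Lemma rounded_load_value v i : overhead v i <= limit ->
  exists g : multiplicities eps, rounded_load v i = load_value g.
Proof.
move=> le_limit.
(* Small jobs get an arbitrary exponent; [P] leaves them out. *)
have expo j : exists k : 'I_(exponent_bound eps), big j -> round eps (q j) = eps * (1 + eps) ^+ k.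
  have [bj|sj] := boolP (big j); last by exists ord0.
  by have [k ->] := round_exponent eps_gt0 bj (scaled_le1 R p m_gt0 j); exists k.
have [kappa kappaP] := choice expo.
pose P j := big j && (onth v j == Some i).
pose c k := #|[pred j | P j && (kappa j == k)]|.
have c_le k : (c k <= multiplicity_bound eps)%N.
  rewrite -ltnS -(@ltr_nat R); apply: le_lt_trans (truncnS_gt _).
  rewrite ler_pdivlMr //; apply: le_trans le_limit.
  rewrite mulr_natl -sumr_const /Defs.overhead big_mkcond [leRHS]big_mkcond.
  apply: ler_sum => j _; rewrite !inE /P.
  case: (onth v j == Some i); rewrite ?andbF // andbT.
  by case: ifP => [/andP[]|_] //; exact: q_ge0.
exists [ffun k => inord (c k)]; rewrite /Defs.rounded_load.
rewrite (partition_big kappa xpredT) //=; apply: eq_bigr => k _.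
rewrite ffunE inordK ?ltnS //.
rewrite (eq_bigr (fun=> eps * (1 + eps) ^+ k)); first by rewrite sumr_const mulr_natl.
by move=> j /andP[/andP[bj _] /eqP <-]; rewrite kappaP.
Qed.

Definition depth_bound : nat := Num.truncn (m%:R / eps).

(** A finite stand-in for depth and profile, recording the profile at possible load values only;
    [inord] is faithful up to depth [depth_bound]. *)
Definition code v : 'I_depth_bound.+1 * {ffun multiplicities eps -> 'I_m.+1} :=
  (inord (size v), [ffun g => inord (profile eps p v (load_value g))]).

Definition within_limit v := forall i, overhead v i <= limit.

Lemma code_inj u v : (size u <= depth_bound)%N -> (size v <= depth_bound)%N ->
  within_limit u -> within_limit v -> code u = code v ->
  size u = size v /\ eps_equivalent eps p u v.
Proof.
move=> su sv lu lv [/(congr1 val) + /ffunP code_eq]; rewrite /= !inordK // => ->.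
split=> //; apply/funext => c.
have profile_le w c' : (profile eps p w c' < m.+1)%N.
  by rewrite ltnS -[X in (_ <= X)%N]card_ord max_card.
have [[g ->]|noc] := pselect (exists g : multiplicities eps, c = load_value g).
  by have /(congr1 val) := code_eq g; rewrite !ffunE /= !inordK.
(* Within the limit, no machine has a rounded load other than these values. *)
have profile0 w : within_limit w -> profile eps p w c = 0%N.
  move=> lw; apply: eq_card0 => i; rewrite !inE; apply/eqP => cE; apply: noc.
  by have [g gE] := rounded_load_value (lw i); exists g; rewrite -cE.
by rewrite !profile0.
Qed.

Definition fixed_big v := forall j : 'I_n, (j < size v)%N -> big j.

Lemma size_le_depth_bound v : (size v <= n)%N -> fixed_big v -> (size v <= depth_bound)%N.
Proof.
move=> vn bigv; rewrite -ltnS -(@ltr_nat R); apply: le_lt_trans (truncnS_gt _).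
rewrite ler_pdivlMr //; apply: le_trans (sum_scaled_le R p m_gt0).
have -> : (size v)%:R * eps = \sum_(j < size v) eps by rewrite sumr_const card_ord mulr_natl.
rewrite (big_ord_widen n (fun=> eps) vn) big_mkcond; apply: ler_sum => j _.
by case: ifP => [/bigv|_] //; exact: q_ge0.
Qed.

(** Equal profiles mean equal multisets of rounded loads. *)
Lemma eps_equivalentP u v : eps_equivalent eps p u v ->
  exists pi : 'S_m, forall i, rounded_load u (pi i) = rounded_load v i.
Proof.
move=> uv; pose t w := [tuple rounded_load w i | i < m].
have : perm_eq (t v) (t u).
  apply/allP => c _ /=; apply/eqP.
  have countE w : count_mem c (t w) = profile eps p w c.
    rewrite /t /= count_map -sum1_count /profile -sum1_card big_enum_cond /=.
    by apply: eq_bigl => i; rewrite inE.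
  by rewrite !countE uv.
move=> /tuple_permP[pi tE]; exists pi => i.
have /(congr1 (fun s => nth 0 s i)) := tE.
by rewrite -!tnth_nth !tnth_mktuple.
Qed.

Section Ideal.
Variable S : schedule n m.

Definition ideal_load d i : R :=
  \sum_(j < n | [&& big j, (j < d)%N & S j == i]) round eps (q j).

(* Nodes are compared with S itself, not with the node they replace, so the
   rounding error does not accumulate along the tree. *)
Definition mimics w := exists pi : 'S_m, forall i,
  rounded_load w (pi i) = ideal_load (size w) i.

Lemma mimics_equivalent u w : size w = size u -> eps_equivalent eps p u w ->
  mimics u -> mimics w.
Proof.
move=> wu /eps_equivalentP[pi piE] [sg sgE].
exists (sg * pi^-1)%g => i; rewrite permM wu -sgE -piE permKV //.
Qed.

Lemma mimics_root : mimics [::].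
Proof.
exists 1%g => i; rewrite perm1 /Defs.rounded_load /ideal_load !big_pred0 //.
  by move=> j; rewrite andbF.
by move=> j; rewrite onth0n andbF.
Qed.

(** The next job goes to the machine that [pi] matches with its machine in [S]. *)
Lemma mimics_child v : (size v < n)%N -> mimics v -> exists i, mimics (rcons v i).
Proof.
move=> vn [pi piE]; pose j := Ordinal vn; exists (pi (S j)), pi => i.
rewrite size_rcons /Defs.rounded_load /ideal_load.
rewrite big_mkcond (bigD1 j) //= [RHS]big_mkcond [RHS](bigD1 j) //=.
rewrite -cats1 onth_cat ltnn subnn /= ltnSn (inj_eq Some_inj) (inj_eq perm_inj).
congr (_ + _).
have := piE i; rewrite /Defs.rounded_load /ideal_load.
rewrite big_mkcond (bigD1 j) //= [in RHS]big_mkcond [in RHS](bigD1 j) //=.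
rewrite onth_default // ltnn !andbF !add0r => rest.
apply: etrans (etrans rest _); apply: eq_bigr => k kj; last first.
  by rewrite ltnS [in RHS]leq_eqVlt -[(k : nat) == _]/(k == j) (negPf kj).
rewrite onth_cat; have [//|vk] := ltnP k (size v).
have ltvk : (size v < k)%N by rewrite ltn_neqAle vk andbT eq_sym.
by rewrite !onth_default //= subn_gt0.
Qed.

(** The unfixed jobs follow [S] through [pi]. On each machine only the fixed part differs from [S],
    and rounding down loses at most a factor [1 + eps] there. *)
Lemma mimics_completion w : fixed_big w -> mimics w ->
  exists S' : schedule n m, (forall (j : 'I_n) i, onth w j = Some i -> S' j = i) /\
    makespan q S' <= (1 + eps) * makespan q S.
Proof.
move=> bigw [pi piE].
pose S' : schedule n m := [ffun j : 'I_n => odflt (pi (S j)) (onth w j)].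
have S'_ext (j : 'I_n) i : onth w j = Some i -> S' j = i by rewrite ffunE => ->.
have e1_ge1 : 1 <= 1 + eps by rewrite lerDl ltW.
have e1_ge0 := le_trans ler01 e1_ge1.
exists S'; split=> //; apply: makespan_le => [|i0].
  by rewrite mulr_ge0 // makespan_ge0.
rewrite -(permKV pi i0); move: (pi^-1%g i0) => i.
apply: le_trans (_ : _ <= (1 + eps) * \sum_(j | S j == i) q j) _; last first.
  by rewrite ler_wpM2l // load_le_makespan.
rewrite (sum_load R p (pi i) S'_ext) [in leRHS](bigID (fun j : 'I_n => (j < size w)%N)) /= mulrDr.
apply: lerD.
  apply: le_trans (_ : _ <= (1 + eps) * rounded_load w (pi i)) _.
    rewrite /Defs.overhead /Defs.rounded_load mulr_sumr.
    rewrite big_mkcond [leRHS]big_mkcond; apply: ler_sum => j _.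
    case: ifP => wj; rewrite ?andbF // andbT.
    have bj : big j by apply: bigw; rewrite -onthTE (eqP wj).
    by rewrite bj le_round.
  rewrite ler_wpM2l // piE /ideal_load big_mkcond [leRHS]big_mkcond.
  apply: ler_sum => j _; rewrite [_ && (j < _)%N]andbC.
  case: ifP => [/andP[bj ->]|_]; first exact: round_le.
  by case: ifP => _ //; exact: q_ge0.
rewrite (sum_unfixed (R := R) w (fun j => S' j == pi i)).
apply: le_trans (ler_peMl _ e1_ge1); last by rewrite sumr_ge0 // => j _; exact: q_ge0.
rewrite le_eqVlt; apply/orP; left; apply/eqP; apply: eq_bigl => j.
rewrite -leqNgt andbC; have [wj|] := leqP (size w) j; rewrite ?andbF // !andbT.
by rewrite ffunE onth_default //= (inj_eq perm_inj).
Qed.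

Lemma mimics_LB w : fixed_big w -> mimics w -> LB w <= (1 + eps) * makespan q S.
Proof.
move=> bigw /(mimics_completion bigw)[S' [S'_ext]]; apply: le_trans.
exact: LB_le_makespan.
Qed.

(** Hence a mimicking node is never discarded for its overhead. *)
Lemma mimics_within_limit w : makespan q S <= 2 -> fixed_big w -> mimics w -> within_limit w.
Proof.
move=> S_le2 bigw /(mimics_completion bigw)[S' [S'_ext S'_le]] i.
apply: le_trans (_ : makespan q S' <= _).
  apply: le_trans (load_le_makespan q S' i); rewrite (sum_load R p i S'_ext) lerDl.
  by rewrite sumr_ge0 // => j _; exact: q_ge0.
apply: le_trans S'_le _.
have e1_ge1 : 1 <= 1 + eps by rewrite lerDl ltW.
rewrite expr2 mulrCA ler_wpM2l ?(le_trans ler01) //.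
by apply: le_trans S_le2 _; rewrite ler_peMr.
Qed.

End Ideal.
End Profiles.

(** * Runs of the algorithm *)

Section Run.
Context (R : realType) (n m : nat) (p : 'I_n -> nat) (m_gt0 : (0 < m)%N).
Context (eps : R) (eps_gt0 : 0 < eps) (O : schedule n m).
Hypothesis p_sorted : forall i j : 'I_n, (i <= j)%N -> (p j <= p i)%N.
Local Notation q := (@scaled R n m p).
Local Notation LB := (@LB R n m p).
Local Notation scale := (@scale R n m p).
Local Notation big := (@big R n m eps p).
Local Notation code := (@code R n m p eps).
Local Notation opt := (makespan q O).
Hypothesis opt_le2 : opt <= 2.
Implicit Types (u v w : node m) (S : schedule n m) (s : state n m).
Implicit Types (fnd : seq (schedule n m)) (dn act gen : seq (node m)).

Local Notation mimics := (mimics p eps O).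
Local Notation fixed_big := (fixed_big p eps).
Local Notation within_limit := (within_limit p eps).

Definition near_optimal fnd := exists2 S, S \in fnd & makespan q S <= (1 + eps) * opt.

(* The witness w' is at least as deep as w, so it survives the removal of a
   processed node at a smaller depth than w. *)
Definition covered fnd act gen (k : nat) := near_optimal fnd \/
  forall w, w \in gen -> (k <= size w)%N -> mimics w ->
    exists2 w', w' \in act & mimics w' /\ (size w <= size w')%N.

(* dn lists the nodes processed so far. *)
Record tree_invariant dn act gen : Prop := {
  codes_uniq : uniq (map code (dn ++ act));
  opened_generated : {subset dn ++ act <= gen};
  opened_within_limit : forall w, w \in dn ++ act -> within_limit w;
  generated_fixed_big : forall w, w \in gen -> (size w <= n)%N /\ fixed_big w;
  root_generated : [::] \in gen }.

(** The clause on [active s] keeps a run from ending without any schedule; the one on [m = 1] serves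
    the node bound, which then has no room for constants. *)
Definition invariant s := exists dn,
  [/\ size dn = processed s, tree_invariant dn (active s) (Defs.generated s),
      covered (found s) (active s) (Defs.generated s) 0,
      found s = [::] -> active s != [::] & m = 1%N -> processed s = 0%N].

Lemma near_optimal_cons S fnd : near_optimal fnd -> near_optimal (S :: fnd).
Proof. by case=> S' S'f S'le; exists S'; rewrite // inE S'f orbT. Qed.

Lemma covered_cons S fnd act gen k : covered fnd act gen k -> covered (S :: fnd) act gen k.
Proof. by case=> [/near_optimal_cons|cov]; [left|right]. Qed.

Lemma exists_best fnd : fnd != [::] -> exists S, best_of R p fnd S.
Proof.
elim: fnd => // S fnd IHfnd _; have [->|fndN0] := eqVneq fnd [::].
  by exists S; split; rewrite ?mem_head // => S'; rewrite inE => /eqP ->.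
have [S1 [S1f S1best]] := IHfnd fndN0.
have [le|lt] := leP (makespan q S) (makespan q S1).
  exists S; split=> [|S']; rewrite ?mem_head // inE => /predU1P[-> //|/S1best].
  exact: le_trans.
exists S1; split=> [|S']; rewrite inE ?S1f ?orbT // => /predU1P[->|/S1best //].
exact: ltW.
Qed.

Lemma exists_selected act : act != [::] -> exists v, selected R p act v.
Proof.
elim: act => // v act IHact _; have [->|actN0] := eqVneq act [::].
  by exists v; split; rewrite ?mem_head // => u; rewrite inE => /eqP ->.
have [w [wact wmin]] := IHact actN0.
have [le|lt] := leP (LB v) (LB w).
  exists v; split=> [|u]; rewrite ?mem_head // inE => /predU1P[-> //|/wmin].
  exact: le_trans.
exists w; split=> [|u]; rewrite inE ?wact ?orbT // => /predU1P[->|/wmin //].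
exact: ltW.
Qed.

Lemma opt_ge0 : 0 <= opt. Proof. exact: makespan_ge0. Qed.

Lemma near_optimal_best fnd S : near_optimal fnd -> best_of R p fnd S ->
  makespan q S <= (1 + eps) * opt.
Proof. by move=> [S1 S1f S1le] [_ /(_ _ S1f)]; move/le_trans; apply. Qed.

Lemma le_square : (1 + eps) * opt <= (1 + eps) ^+ 2 * opt.
Proof.
have e1_ge1 : 1 <= 1 + eps by rewrite lerDl ltW.
by rewrite ler_wpM2r ?opt_ge0 // expr2 ler_peMr // (le_trans ler01).
Qed.

(** The root mimics every schedule, so covering it yields an active mimicking node. *)
Lemma covered_lower_bound dn act gen fnd : tree_invariant dn act gen ->
    covered fnd act gen 0 ->
  near_optimal fnd \/ exists2 w, w \in act & LB w <= (1 + eps) * opt.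
Proof.
move=> tree [|cov]; first by left.
have [w wact [mw _]] := cov _ (root_generated tree) isT (mimics_root p eps O).
right; exists w => //; apply: mimics_LB => //.
apply: (generated_fixed_big tree _).2; apply: (opened_generated tree).
by rewrite mem_cat wact orbT.
Qed.

Lemma makespan_eq0 S : scale = 0 -> makespan q S = 0.
Proof.
move=> s0; apply/le_anti; rewrite makespan_ge0 andbT.
by apply: makespan_le => // i; rewrite big1 // => j _; rewrite scaled_eq0.
Qed.

Lemma gap_closed_approximate dn act gen fnd S : tree_invariant dn act gen ->
    covered fnd act gen 0 -> gap_closed eps p fnd act -> best_of R p fnd S ->
  makespan q S <= (1 + eps) ^+ 2 * opt.
Proof.
move=> tree cov [S1 [S1f _] gap] best.
have [near|[w wact LBw]] := covered_lower_bound tree cov.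
  exact: le_trans (near_optimal_best near best) le_square.
(* For [scale = 0] the ratio in the stopping rule divides by 0 and carries no information. *)
have [s0|sN0] := eqVneq scale 0; first by rewrite !makespan_eq0 // mulr0.
have s_gt0 : 0 < scale by rewrite lt_def sN0 scale_ge0.
have LB_gt0 : 0 < LB w by rewrite (lt_le_trans ltr01) // LB_ge1.
apply: le_trans (best.2 _ S1f) _; have := gap _ wact.
rewrite ler_pdivrMr // => /le_trans; apply.
by rewrite expr2 -mulrA ler_wpM2l // addr_ge0 // ltW.
Qed.

(** As [v] has the smallest lower bound, the makespan is at most [LB v + eps <= (1 + eps) * LB u],
    using [1 <= LB u]. *)
Lemma small_gap_closed fnd act v x S : selected R p act v ->
    bounding_vertex p x -> @matching_schedule R n m v x S ->
    (forall j : 'I_n, (size v <= j)%N -> ~~ big j) ->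
  gap_closed eps p (S :: fnd) act.
Proof.
move=> [_ vmin] [vx _] match_x small.
have [S1 best] := exists_best (isT : S :: fnd != [::]); exists S1 => // u uact.
have [s0|sN0] := eqVneq scale 0.
  by rewrite makespan_eq0 // mul0r addr_ge0 // ltW.
have s_gt0 : 0 < scale by rewrite lt_def sN0 scale_ge0.
have LBu_ge1 : 1 <= LB u by rewrite LB_ge1.
rewrite ler_pdivrMr ?(lt_le_trans ltr01) //.
apply: le_trans (best.2 _ (mem_head _ _)) _.
have le_v : makespan q S <= LB v + eps.
  apply: (matching_schedule_makespan m_gt0 vx match_x); first exact: ltW.
  by case=> j vj _ /=; have := small j vj; rewrite -ltNge => /ltW.
have : eps <= eps * LB u by rewrite ler_peMr // ltW.
by have := vmin _ uact; move: le_v; lra.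
Qed.

(** If a mimicking [u] is discarded by its lower bound, the schedule beating it is near-optimal; if
    by equivalence, the equivalent generated node mimics too. A kept [u] has a new code, for an
    equal code would make it equivalent to an opened node. *)
Lemma add_child_invariant fnd dn ag u k : tree_invariant dn ag.1 ag.2 ->
    covered fnd ag.1 ag.2 k -> (size u <= n)%N -> fixed_big u ->
  let ag' := add_child eps p fnd ag u in
  tree_invariant dn ag'.1 ag'.2 /\ covered fnd ag'.1 ag'.2 k.
Proof.
case: ag => act gen /= tree cov un bigu.
have gen_sub : {subset gen <= rcons gen u} by move=> w wgen; rewrite mem_rcons inE wgen orbT.
have u_gen : u \in rcons gen u by rewrite mem_rcons mem_head.
have gen_fixed w : w \in rcons gen u -> (size w <= n)%N /\ fixed_big w.
  by rewrite mem_rcons inE => /predU1P[-> //|]; exact: (generated_fixed_big tree).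
have root_gen := gen_sub _ (root_generated tree).
rewrite /add_child; case: asboolP => [disc|keep] /=; split=> //.
- split; rewrite ?gen_fixed //; [exact: codes_uniq tree| |exact: opened_within_limit tree].
  by move=> w /(opened_generated tree) /gen_sub.
- case: cov => [|cov]; first by left.
  have [near|notnear] := pselect (near_optimal fnd); [by left|right].
  move=> w; rewrite mem_rcons inE => /predU1P[->|]; last exact: cov.
  move=> ku mu; case: disc => [[S Sf ltS]|[i]|[w' w'gen [w'u equ]]].
  + by case: notnear; exists S => //; rewrite (le_trans (ltW ltS)) // mimics_LB.
  + by rewrite ltNge (mimics_within_limit m_gt0 eps_gt0 opt_le2 bigu mu).
  + by rewrite -w'u; apply: cov; rewrite ?w'u //; exact: mimics_equivalent mu.
- have u_limit : within_limit u.
    by move=> i; rewrite leNgt; apply/negP => lt; apply: keep; apply: Or32; exists i.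
  split; rewrite -?rcons_cat //.
  + rewrite map_rcons rcons_uniq (codes_uniq tree) andbT.
    apply/mapP => -[w w_open cE]; apply: keep; apply: Or33.
    have w_gen := opened_generated tree w_open.
    have [wn bigw] := generated_fixed_big tree w_gen.
    have [suw equw] := code_inj m_gt0 eps_gt0
      (size_le_depth_bound m_gt0 eps_gt0 un bigu)
      (size_le_depth_bound m_gt0 eps_gt0 wn bigw)
      u_limit (opened_within_limit tree w_open) cE.
    by exists w.
  + move=> w; rewrite mem_rcons inE => /predU1P[-> //|].
    by move=> /(opened_generated tree) /gen_sub.
  + move=> w; rewrite mem_rcons inE => /predU1P[-> //|].
    exact: (opened_within_limit tree).
- case: cov => [|cov]; [by left|right] => w.
  rewrite mem_rcons inE => /predU1P[-> ku mu|wgen kw mw].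
    by exists u; rewrite // mem_rcons mem_head.
  have [w' w'act w'P] := cov w wgen kw mw.
  by exists w' => //; rewrite mem_rcons inE w'act orbT.
Qed.

Lemma add_children_invariant fnd dn us ag k : tree_invariant dn ag.1 ag.2 ->
    covered fnd ag.1 ag.2 k ->
    (forall u, u \in us -> (size u <= n)%N /\ fixed_big u) ->
  let ag' := foldl (add_child eps p fnd) ag us in
  tree_invariant dn ag'.1 ag'.2 /\ covered fnd ag'.1 ag'.2 k.
Proof.
elim: us ag => [|u us IHus] ag tree cov us_fixed; first by split.
have [un bigu] := us_fixed u (mem_head _ _).
have [tree1 cov1] := add_child_invariant tree cov un bigu.
apply: IHus => // w w_us; apply: us_fixed; by rewrite inE w_us orbT.
Qed.

Lemma generated_add_children fnd us ag :
  (foldl (add_child eps p fnd) ag us).2 = ag.2 ++ us.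
Proof. by elim: us ag => [|u us IHus] ag /=; rewrite ?cats0 // IHus cat_rcons. Qed.

Lemma active_add_children fnd us ag :
  {subset ag.1 <= (foldl (add_child eps p fnd) ag us).1}.
Proof.
elim: us ag => [|u us IHus] ag w wag //=; apply: IHus; rewrite /add_child /=.
by case: ifP => // _; rewrite mem_rcons inE wag orbT.
Qed.

Lemma single_machine_integral v (x : {ffun unfixed n v * 'I_m -> R}) :
  m = 1%N -> bounding_vertex p x -> integral x.
Proof.
move=> m1 [[/= + _] _] j i; rewrite node_LP_polytope // => -[_ /(_ j) + _].
have ord_eq0 (l : 'I_m) : l = 0%N :> nat.
  by apply/eqP; rewrite -leqn0 -ltnS -[X in (_ < X)%N]m1 ltn_ord.
rewrite (bigD1 i) //= big1 ?addr0 => [->|k /negP ki]; first exact: rpred1.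
by case: ki; apply/eqP/val_inj; rewrite /= !ord_eq0.
Qed.

(** Removing [v] may lose the witness of nodes no deeper than [v]; a mimicking child of [v] restores
    it. *)
Lemma branch_invariant s v x S : invariant s -> selected R p (active s) v ->
    bounding_vertex p x -> ~ integral x -> @matching_schedule R n m v x S ->
    ~ gap_closed eps p (S :: found s) (active s) ->
  invariant (branch eps p (S :: found s) s v).
Proof.
move=> [dn [dn_size tree cov _ _]] sel_v bv nint match_x ngap.
have [v_act _] := sel_v.
have v_open : v \in dn ++ active s by rewrite mem_cat v_act orbT.
have [_ bigv] := generated_fixed_big tree (opened_generated tree v_open).
have vn : (size v < n)%N.
  rewrite ltnNge; apply/negP => nv; apply: nint => -[j vj].
  by have := ltn_ord j; rewrite ltnNge (leq_trans nv vj).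
(* Otherwise all unfixed jobs are small, and the gap would have closed. *)
have big_next : big (Ordinal vn).
  apply/negPn/negP => small; apply: ngap.
  apply: small_gap_closed sel_v bv match_x _ => j vj.
  apply: contra small; rewrite /Defs.big => /le_trans; apply.
  by rewrite ler_wpM2r ?invr_ge0 ?scale_ge0 // ler_nat p_sorted.
have m_neq1 : m <> 1%N by move=> m1; apply: nint; exact: single_machine_integral bv.
have uniq_act : uniq (active s).
  by have /map_uniq := codes_uniq tree; rewrite cat_uniq => /and3P[].
set act0 := filter (predC1 v) (active s).
have perm_open : perm_eq (dn ++ active s) ((v :: dn) ++ act0).
  rewrite /act0 -rem_filter // -[v :: dn]cat1s -catA perm_sym perm_catCA perm_cat2l.
  by rewrite perm_sym perm_to_rem.
have tree0 : tree_invariant (v :: dn) act0 (Defs.generated s).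
  split; [|move=> w|move=> w|exact: generated_fixed_big tree|exact: root_generated tree].
  - by rewrite -(perm_uniq (perm_map _ perm_open)); exact: codes_uniq tree.
  - by rewrite -(perm_mem perm_open) => /(opened_generated tree).
  - by rewrite -(perm_mem perm_open) => /(opened_within_limit tree).
have cov1 := covered_cons S cov.
have cov0 : covered (S :: found s) act0 (Defs.generated s) (size v).+1.
  case: cov1 => [|cov1]; [by left|right] => w wgen vw mw.
  have [w' w'act [mw' ww']] := cov1 w wgen isT mw.
  exists w' => //; rewrite mem_filter w'act andbT /=.
  by apply: contraTneq (leq_trans vw ww') => ->; rewrite ltnn.
pose us := [seq rcons v i | i <- enum 'I_m].
have us_fixed u : u \in us -> (size u <= n)%N /\ fixed_big u.
  case/mapP => i _ ->; split; first by rewrite size_rcons.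
  move=> j; rewrite size_rcons ltnS leq_eqVlt => /predU1P[jE|]; last exact: bigv.
  by have -> : j = Ordinal vn by apply: val_inj.
have [tree' cov'] := add_children_invariant (ag := (act0, _)) tree0 cov0 us_fixed.
exists (v :: dn); split; rewrite /= ?dn_size //.
have [near|notnear] := pselect (near_optimal (S :: found s)); [by left|right].
case: cov' cov1 => [//|cov'] [//|cov1] w wgen _ mw.
have [vw|wv] := ltnP (size v) (size w); first exact: cov'.
move: (wgen); rewrite generated_add_children mem_cat => /orP[w_old|/mapP[i _ wE]]; last first.
  by move: wv; rewrite wE size_rcons ltnn.
have [w' w'act [mw' ww']] := cov1 w w_old isT mw.
(* If the witness was [v] itself, its child following [O] has been generated and is deeper than [v],
   so [cov'] gives a new witness. *)
have [w'v|w'Nv] := eqVneq w' v; last first.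
  exists w' => //; apply: active_add_children.
  by rewrite mem_filter w'act andbT.
rewrite w'v in mw'; have [i mu] := mimics_child vn mw'.
have [|||w'' w''act [mw'' uw'']] := cov' (rcons v i) => //.
- by rewrite generated_add_children mem_cat map_f ?orbT // mem_enum.
- by rewrite size_rcons.
by exists w'' => //; split=> //; apply: leq_trans uw''; rewrite size_rcons ltnW.
Qed.

(** The number of possible codes. *)
Definition node_bound : nat :=
  (depth_bound m eps).+1 * m.+1 ^ #|{: multiplicities eps}|.

Lemma opened_le_node_bound dn act gen : tree_invariant dn act gen ->
  (size dn + size act <= node_bound)%N.
Proof.
move=> tree; rewrite -size_cat -(size_map code).
have /card_uniqP <- := codes_uniq tree; apply: leq_trans (max_card _) _.
by rewrite card_prod card_ffun !card_ord.
Qed.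

Definition outcome S (N : nat) :=
  [/\ makespan q S <= (1 + eps) ^+ 2 * opt, (N <= node_bound)%N & m = 1%N -> N = 0%N].

Lemma invariant_step s : invariant s -> exists c, step eps p s c.
Proof.
move=> [dn [_ tree _ act_ne _]].
have [gap|ngap] := pselect (gap_closed eps p (found s) (active s)).
  by have [S best _] := gap; exists (Returned S (processed s)); exact: step_terminate.
have act_neq0 : active s != [::].
  have [/act_ne //|fnd_neq0] := eqVneq (found s) [::].
  apply/negP => /eqP act0; apply: ngap; rewrite act0.
  by have [S best] := exists_best fnd_neq0; exists S.
have [v sel] := exists_selected act_neq0.
have [x bv] := exists_bounding_vertex R m_gt0 v p_sorted.
have [S match_x] := exists_matching_schedule m_gt0 bv.1.
have [S1 best] := exists_best (isT : S :: found s != [::]).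
have [xint|xnint] := pselect (integral x).
  by exists (Returned S1 (processed s)); exact: (step_integral ngap sel bv xint match_x best).
have [gap1|ngap1] := pselect (gap_closed eps p (S :: found s) (active s)).
  by exists (Returned S1 (processed s).+1); exact: (step_bounded ngap sel bv xnint match_x gap1 best).
by exists (Running (branch eps p (S :: found s) s v)); exact: (step_branch ngap sel bv xnint match_x ngap1).
Qed.

Lemma step_returns s c : step eps p s c -> invariant s ->
    (forall s', invariant s' -> processed s' = (processed s).+1 ->
       returns eps p outcome (Running s')) ->
  returns eps p outcome c.
Proof.
case=> {s c} [s S gap best|s v x S0 S _ sel bv xint match_x best
    |s v x S0 S _ sel bv xnint _ gap best|s v x S0 _ sel bv xnint match_x ngap] inv IH.
- have [dn [dn_size tree cov _ m1]] := inv; apply: returns_done; split=> //.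
    exact: gap_closed_approximate tree cov gap best.
  by rewrite -dn_size (leq_trans (leq_addr _ _) (opened_le_node_bound tree)).
- have [dn [dn_size tree cov _ m1]] := inv; apply: returns_done; split=> //; last first.
    by rewrite -dn_size (leq_trans (leq_addr _ _) (opened_le_node_bound tree)).
  (* By best-first selection [S0] has makespan at most [LB v <= LB w] for an active [w] with
     [LB w <= (1 + eps) * opt]. *)
  apply: le_trans le_square; apply: near_optimal_best best.
  have [near|[w wact LBw]] := covered_lower_bound tree cov; first exact: near_optimal_cons.
  exists S0; first exact: mem_head.
  apply: le_trans LBw; apply: le_trans (sel.2 _ wact); rewrite -[leRHS]addr0.
  by apply: (matching_schedule_makespan m_gt0 bv.1 match_x) => // j [i /negP[]].
- have [dn [dn_size tree cov _ m1]] := inv; apply: returns_done; split=> //.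
  + exact: gap_closed_approximate tree (covered_cons S0 cov) gap best.
  (* The node [v] is counted through the nonempty [active s]. *)
  + rewrite -dn_size -addn1; apply: leq_trans (opened_le_node_bound tree).
    by rewrite leq_add2l; case: (active s) sel => // -[].
  + by move=> /single_machine_integral/(_ bv).
- by apply: IH => //; exact: branch_invariant sel bv xnint match_x ngap.
Qed.

Lemma invariant_returns s : invariant s -> returns eps p outcome (Running s).
Proof.
(* Processed nodes have distinct codes, so this measure is positive before each branching and drops
   by it. *)
have [k] := ubnP (node_bound - processed s)%N.
elim: k => // k IHk in s *; rewrite ltnS => le_k inv.
apply: returns_step => [|c stc]; first exact: invariant_step.
apply: step_returns stc inv _ => s' inv' s'E; apply: IHk => //.
have [dn [dn_size tree _ _ _]] := inv'.
have := leq_trans (leq_addr _ _) (opened_le_node_bound tree).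
rewrite dn_size s'E => lt_bound; apply: leq_trans le_k.
by rewrite ltn_sub2l.
Qed.

Lemma initial_returns : returns eps p outcome (initial n m).
Proof.
apply: invariant_returns; exists [::]; split=> //=; last first.
  by right=> w; rewrite inE => /eqP -> _ mw; exists [::]; rewrite ?mem_head.
split=> // [w|w]; rewrite inE => /eqP ->; last by split.
move=> i; rewrite /overhead big_pred0 => [|j]; last by rewrite onth0n.
by rewrite mulr_ge0 ?exprn_ge0 // addr_ge0 // ltW.
Qed.

End Run.

(* For m = 1 no power of m can absorb the constants. *)
Lemma node_bound_le (R : realType) (eps : R) (m N : nat) : 0 < eps -> (0 < m)%N ->
    (N <= node_bound m eps)%N -> (m = 1%N -> N = 0%N) ->
  N%:R <= 2 * m%:R ^+ (2 * #|{: multiplicities eps}| + (Num.truncn eps).+1 + 1) / eps.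
Proof.
move=> eps_gt0 m_gt0 N_le N0; set g := #|_|; set e := (Num.truncn eps).+1.
have [m1|m_neq1] := eqVneq m 1%N.
  by rewrite N0 // divr_ge0 ?mulr_ge0 ?exprn_ge0 ?ler0n // ltW.
have m_ge2 : (1 < m)%N by rewrite ltn_neqAle eq_sym m_neq1.
have m_ge1 : 1 <= m%:R :> R by rewrite ler1n.
(* For [m >= 2] a power of [m] exceeds [eps]; it absorbs the extra 1 in the number of depths. *)
have eps_le : eps <= m%:R ^+ (e + 1).
  apply: le_trans (ltW (truncnS_gt eps)) _; rewrite -natrX ler_nat.
  by rewrite ltnW // (leq_trans (ltn_expl _ m_ge2)) // leq_pexp2l // leq_addr.
have depth_le : (depth_bound m eps).+1%:R <= 2 * m%:R ^+ (e + 1) / eps.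
  apply: (@le_trans _ _ (m%:R / eps + 1)).
    by rewrite -natr1 lerD2r truncn_le divr_ge0 ?ler0n // ltW.
  rewrite ler_pdivlMr // mulrDl divfK ?gt_eqF // mul1r.
  have : m%:R <= m%:R ^+ (e + 1) :> R by rewrite -natrX ler_nat -{1}[m]expn1 leq_pexp2l // leq_addl.
  by move: eps_le; lra.
(* For [m >= 2], [m + 1 <= m ^ 2]. *)
have codes_le : (m.+1 ^ g)%:R <= m%:R ^+ (2 * g) :> R.
  rewrite -natrX ler_nat expnM; have [->//|g_gt0] := posnP g.
  by rewrite leq_exp2r // -mulnn (leq_trans _ (leq_mul m_ge2 (leqnn m))) // mul2n -addnn -addn1 leq_add2l.
apply: (@le_trans _ _ (node_bound m eps)%:R); first by rewrite ler_nat.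
rewrite natrM -addnA exprD [2 * _]mulrCA -mulrA mulrC.
by apply: ler_pM; rewrite ?ler0n.
Qed.

(** * Renumbering the jobs and conclusion *)

Lemma makespan_perm (R : realType) (n m : nat) (t : 'I_n -> R) (S : schedule n m)
    (s : {perm 'I_n}) :
  makespan (fun j => t (s j)) [ffun j => S (s j)] = makespan t S.
Proof.
apply: eq_bigr => i _; rewrite [RHS](reindex_inj (@perm_inj _ s)).
by apply: eq_bigl => j; rewrite ffunE.
Qed.

Lemma returns_monotone (R : realType) (n m : nat) (eps : R) (p : 'I_n -> nat)
    (Q Q' : schedule n m -> nat -> Prop) c : (forall S N, Q S N -> Q' S N) ->
  returns eps p Q c -> returns eps p Q' c.
Proof.
move=> QQ'; elim=> [S N /QQ'|s ex_c _ IH]; first exact: returns_done.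
exact: returns_step.
Qed.

Theorem theorem4 (R : realType) :
  exists f : R -> nat,
    forall (eps : R), 0 < eps ->
    forall (n m : nat) (p : 'I_n -> nat), (0 < m)%N ->
      A_eq_prof_returns eps p
        (fun (S : schedule n m) (N : nat) =>
           approximate_solution ((1 + eps) ^+ 2) p S /\
           N%:R <= 2 * m%:R ^+ (f eps + 1) / eps).
Proof.
(* The first term turns [(m + 1) ^ g] into a power of [m]; the second absorbs the rounding of the
   depth bound. *)
exists (fun eps => 2 * #|{: multiplicities eps}| + (Num.truncn eps).+1)%N.
move=> eps eps_gt0 n m p m_gt0 s p_sorted.
pose q := @scaled R n m (fun j => p (s j)).
have [S0 S0_le2] := exists_schedule_le2 R (fun j => p (s j)) m_gt0.
(* An optimal schedule, compared with the list schedule to get a makespan of at most 2. *)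
pose O := [arg min_(S < S0) makespan q S]%O.
have O_min (S : schedule n m) : makespan q O <= makespan q S by rewrite /O; case: arg_minP => // S1 _ /(_ S isT).
have O_le2 : makespan q O <= 2 by apply: le_trans S0_le2.
apply: returns_monotone (initial_returns m_gt0 eps_gt0 p_sorted O_le2).
move=> S N [approx N_le N0]; split; last exact: node_bound_le.
move=> S'; have SE : [ffun j => [ffun j => S ((s^-1)%g j)] (s j)] = S :> schedule n m.
  by apply/ffunP => j; rewrite !ffunE permK.
rewrite -!(makespan_perm (fun j => (p j)%:R) _ s) SE !makespan_scaled // mulrA.
rewrite ler_wpM2r ?scale_ge0 //; apply: le_trans approx _.
by rewrite ler_wpM2l ?O_min // exprn_ge0 // addr_ge0 // ltW.
Qed.
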